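(* For a closed Riemannian manifold $(M^n,g)$, $n\geq 4$, with harmonic Weyl curvature, one has pointwise \[\Delta |W|^2=2|\nabla W|^2-4\left\langle W,\,W^2+W^\sharp\right\rangle +2\left\langle \mathrm{Rc}\circ g,\, W^2\right\rangle.\]
   Context: Indices refer to a local orthonormal frame. The Riemann curvature $(4,0)$-tensor $R$ has the sign for which $R(X,Y,X,Y)$ is the sectional curvature of an orthonormal pair. $\mathrm{Rc}_{ik}=\sum_jR_{ijkj}$, $S=\mathrm{tr}\,\mathrm{Rc}$. Kulkarni–Nomizu product of symmetric 2-tensors: $(h\circ k)(X,Y,Z,T)=h(X,Z)k(Y,T)+k(X,Z)h(Y,T)-h(X,T)k(Y,Z)-k(X,T)h(Y,Z)$. Weyl tensor: $W=R-\frac{1}{n-2}\mathrm{Rc}\circ g+\frac{S}{2(n-1)(n-2)}g\circ g$. Harmonic Weyl curvature means $(\delta W)_{ijk}=\sum_m\nabla_mW_{ijkm}\equiv0$. Quadratic products: $(W^2)_{ijkl}=\frac12\sum_{p,q}W_{ijpq}W_{klpq}$ and $(W^\sharp)_{ijkl}=\sum_{p,q}(W_{ipkq}W_{jplq}-W_{iplq}W_{jpkq})$. Inner products and norms: $\langle T,U\rangle=\frac14\sum_{i,j,k,l}T_{ijkl}U_{ijkl}$ for $(4,0)$-tensors, $|W|^2=\langle W,W\rangle$, $|\nabla W|^2=\sum_i\sum_{a<b;\,c<d}(\nabla_iW_{abcd})^2$. $\Delta$ is the trace of the Hessian. *)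

(* Defs.v *)
From HB Require Import structures.
From mathcomp Require Import all_boot all_order all_algebra.
From mathcomp Require Import all_classical all_reals all_analysis.

Set Implicit Arguments.
Unset Strict Implicit.
Unset Printing Implicit Defensive.

Import Order.TTheory GRing.Theory Num.Theory.
Import numFieldNormedType.Exports.

Local Open Scope classical_set_scope.
Local Open Scope ring_scope.

(* [Ck k U f] is meant for open [U]; [f] may take arbitrary values off [U]. *)
Fixpoint Ck (R : realType) (V W : normedModType R) (k : nat) (U : set V)
    (f : V -> W) : Prop :=
  match k with
  | 0 => forall x, U x -> {for x, continuous f}
  | k'.+1 => (forall x, U x -> differentiable f x) /\
             (forall v : V, Ck k' U (fun x => 'D_v f x))
  end.

Definition smooth_on (R : realType) (V W : normedModType R) (U : set V)
    (f : V -> W) : Prop := forall k, Ck k U f.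

(* A chart is a homeomorphism between an open subset [dom] of [M] and an open
   subset of R^n; [inv_chart] is only meaningful on the image. *)
Record chart (R : realType) (n : nat) (M : topologicalType) := Chart {
  dom : set M ;
  chart_fun :> M -> 'rV[R]_n ;
  inv_chart : 'rV[R]_n -> M ;
  chart_dom_open : open dom ;
  chart_img_open : open (chart_fun @` dom) ;
  chartK : forall p, dom p -> inv_chart (chart_fun p) = p ;
  chart_continuous : forall p, dom p -> {for p, continuous chart_fun} ;
  inv_chart_continuous :
    forall x, (chart_fun @` dom) x -> {for x, continuous inv_chart}
}.

Definition chart_img (R : realType) (n : nat) (M : topologicalType)
  (c : chart R n M) : set 'rV[R]_n := c @` dom c.

Definition transition (R : realType) (n : nat) (M : topologicalType)
  (a b : chart R n M) : 'rV[R]_n -> 'rV[R]_n := fun x => b (inv_chart a x).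

(* Closed = compact without boundary.  Second countability is not listed: it
   follows from compactness and the existence of charts. *)
Record closedManifold (R : realType) (n : nat) := ClosedManifold {
  carrier :> topologicalType ;
  atlas : set (chart R n carrier) ;
  carrier_hausdorff : hausdorff_space carrier ;
  carrier_compact : compact [set: carrier] ;
  atlas_cover : forall p : carrier, exists2 c, atlas c & dom c p ;
  atlas_smooth : forall a b, atlas a -> atlas b ->
    smooth_on (a @` (dom a `&` dom b)) (transition a b)
}.

Section LocalGeometry.
Variables (R : realType) (n : nat).

(* Tangent vectors of a chart domain are row vectors, vector fields are
   functions on R^n, and a metric is given by its Gram matrix [G x]. *)
Notation vfield := ('rV[R]_n -> 'rV[R]_n).
Notation tensor2 := (vfield -> vfield -> 'rV[R]_n -> R).
Notation tensor4 := (vfield -> vfield -> vfield -> vfield -> 'rV[R]_n -> R).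
Notation array4 := ('I_n -> 'I_n -> 'I_n -> 'I_n -> R).

Definition inner (A : 'M[R]_n) (u v : 'rV[R]_n) : R := (u *m A *m v^T) 0 0.

Implicit Types (G : 'rV[R]_n -> 'M[R]_n) (X Y Z T V : vfield)
  (x : 'rV[R]_n) (e : 'I_n -> vfield) (U : set 'rV[R]_n) (f : 'rV[R]_n -> R).

Definition partial (i : 'I_n) f x : R := 'D_(delta_mx 0 i) f x.

Definition christoffel G x (k i j : 'I_n) : R :=
  2^-1 * \sum_l invmx (G x) k l *
    (partial i (fun y => G y j l) x + partial j (fun y => G y i l) x
     - partial l (fun y => G y i j) x).

Definition nabla G X Y : vfield := fun x =>
  'D_(X x) Y x +
  \row_k \sum_i \sum_j christoffel G x k i j * X x 0 i * Y x 0 j.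

Definition lie_bracket X Y : vfield := fun x => 'D_(X x) Y x - 'D_(Y x) X x.

Definition curvature G X Y Z : vfield := fun x =>
  nabla G X (nabla G Y Z) x - nabla G Y (nabla G X Z) x
  - nabla G (lie_bracket X Y) Z x.

Definition metric_tensor G : tensor2 := fun X Y x => inner (G x) (X x) (Y x).

(* R(X,Y,Z,T) = <R(X,Y)T, Z>, so that R(X,Y,X,Y) is the sectional curvature. *)
Definition Riem G : tensor4 := fun X Y Z T x =>
  inner (G x) (curvature G X Y T x) (Z x).

Definition orthonormal_frame G U e : Prop :=
  (forall i, smooth_on U (e i)) /\
  (forall x, U x -> forall i j, inner (G x) (e i x) (e j x) = (i == j)%:R).

Definition Ric G e : tensor2 := fun X Z x => \sum_j Riem G X (e j) Z (e j) x.

Definition scal G e x : R := \sum_i Ric G e (e i) (e i) x.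

Definition KN (h k : tensor2) : tensor4 := fun X Y Z T x =>
  h X Z x * k Y T x + k X Z x * h Y T x - h X T x * k Y Z x - k X T x * h Y Z x.

Definition Weyl G e : tensor4 := fun X Y Z T x =>
  Riem G X Y Z T x
  - (n%:R - 2)^-1 * KN (Ric G e) (metric_tensor G) X Y Z T x
  + scal G e x / (2 * (n%:R - 1) * (n%:R - 2)) *
    KN (metric_tensor G) (metric_tensor G) X Y Z T x.

Definition nabla4 G V (A : tensor4) : tensor4 := fun X Y Z T x =>
  'D_(V x) (A X Y Z T) x
  - A (nabla G V X) Y Z T x - A X (nabla G V Y) Z T x
  - A X Y (nabla G V Z) T x - A X Y Z (nabla G V T) x.

Definition hessian G f : tensor2 := fun X Y x =>
  'D_(X x) (fun y => 'D_(Y y) f y) x - 'D_(nabla G X Y x) f x.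

Definition laplacian G e f x : R := \sum_i hessian G f (e i) (e i) x.

Definition comps e (A : tensor4) x : array4 := fun i j k l =>
  A (e i) (e j) (e k) (e l) x.

Definition inner4 (A B : array4) : R :=
  4^-1 * \sum_i \sum_j \sum_k \sum_l A i j k l * B i j k l.

Definition sq4 (A : array4) : array4 := fun i j k l =>
  2^-1 * \sum_p \sum_q A i j p q * A k l p q.

Definition sharp4 (A : array4) : array4 := fun i j k l =>
  \sum_p \sum_q (A i p k q * A j p l q - A i p l q * A j p k q).

Definition weyl_comps G e x : array4 := comps e (Weyl G e) x.

Definition nabla_weyl_comps G e x (m : 'I_n) : array4 :=
  comps e (nabla4 G (e m) (Weyl G e)) x.

Definition div_weyl G e x (i j k : 'I_n) : R :=
  \sum_m nabla_weyl_comps G e x m i j k m.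

Definition weyl_normsq G e x : R := inner4 (weyl_comps G e x) (weyl_comps G e x).

Definition nabla_weyl_normsq G e x : R :=
  \sum_i \sum_(a < n) \sum_(b < n | (a < b)%N)
         \sum_(c < n) \sum_(d < n | (c < d)%N)
    nabla_weyl_comps G e x i a b c d ^+ 2.

End LocalGeometry.

(* [gram c x] is the Gram matrix, in the chart [c], of the metric at the point
   with coordinates [x]; only charts of the atlas matter. *)
Record riemannianMetric (R : realType) (n : nat) (M : closedManifold R n) :=
  RiemannianMetric {
  gram :> chart R n M -> 'rV[R]_n -> 'M[R]_n ;
  gram_smooth : forall c, atlas c -> smooth_on (chart_img c) (gram c) ;
  gram_sym : forall c, atlas c -> forall x, chart_img c x ->
    (gram c x)^T = gram c x ;
  gram_pos : forall c, atlas c -> forall x, chart_img c x ->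
    forall u : 'rV[R]_n, u != 0 -> 0 < inner (gram c x) u u ;
  gram_compat : forall a b, atlas a -> atlas b ->
    forall p, dom a p -> dom b p -> forall u v : 'rV[R]_n,
    inner (gram a (a p)) u v =
    inner (gram b (b p)) ('D_u (transition a b) (a p))
                         ('D_v (transition a b) (a p))
}.

Definition local_onframe (R : realType) (n : nat) (M : closedManifold R n)
    (g : riemannianMetric M) (c : chart R n M) (U : set 'rV[R]_n)
    (e : 'I_n -> 'rV[R]_n -> 'rV[R]_n) : Prop :=
  [/\ atlas c, open U, U `<=` chart_img c & orthonormal_frame (g c) U e].

Definition harmonic_weyl (R : realType) (n : nat) (M : closedManifold R n)
    (g : riemannianMetric M) : Prop :=
  forall c U e, local_onframe g c U e ->
  forall x, U x -> forall i j k, div_weyl (g c) e x i j k = 0.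

(* Main.v *)
Require Import Defs.
From HB Require Import structures.
From mathcomp Require Import all_boot all_order all_algebra.
From mathcomp Require Import all_classical all_reals all_analysis.
From mathcomp Require Import ring.
Import Order.TTheory GRing.Theory Num.Theory.
Import numFieldNormedType.Exports.

Set Implicit Arguments.
Unset Strict Implicit.
Unset Printing Implicit Defensive.

Local Open Scope classical_set_scope.
Local Open Scope ring_scope.

(** The identity is a Bochner computation.  Write the curvature as
    R = W + A o g, with A the Schouten tensor.  The second Bianchi identity for
    R turns the cyclic sum of nabla W into an expression in g and the Cotton
    tensor C, the antisymmetrised derivative of A.  When W is divergence free
    the trace of this expression is (n - 3) C plus multiples of the trace of C,
    and both vanish because n >= 4 ([cotton0]).  So W itself satisfies the
    second Bianchi identity ([W_bianchi2]).  Differentiating that identity and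
    tracing it writes Delta W through commutators of covariant derivatives,
    since the divergence terms drop out ([hess4_trace]), and by the Ricci
    identity ([cov4_comm]) these commutators are bilinear in R and W.  After
    contraction with W, the trace of R gives the Ricci term, the W part of R
    gives W^2 and W^sharp, and the contributions of A o g to the other terms
    cancel ([dot4_ricci_terms]).  The Leibniz rule, with the metric parallel,
    turns <W, Delta W> into Delta |W|^2 ([laplacian_dot4]).

    All of this takes place in the commutative ring of smooth functions on the
    domain U of the orthonormal frame e.  A tensor is the array of its frame
    components, the frame acts by derivations D_i, and the Levi-Civita
    connection is an array om with om i a p = <nabla_{e_i} e_p, e_a>.  The
    calculation uses three facts about these data: om is skew in its last two
    indices (the metric is parallel), [D_i, D_j] is the combination of the D_p
    with coefficients om i p j - om j p i (there is no torsion), and these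
    coefficients satisfy the Jacobi identity.  The three facts follow
    algebraically from the coordinate formula for the Christoffel symbols and
    from the commutation of partial derivatives ([derive_comm]).

    The link with the pointwise definitions is tensoriality: a vector field
    with smooth frame components enters Riem, Ric and Weyl only through these
    components ([tens4_riem], [tens4_weyl]), so that nabla_X of a tensor on
    frame fields is the derivative of an array ([nabla4_frame]). *)

(** * Sums against the Kronecker symbol *)

Section Kronecker.
Variables (F : comPzRingType) (n : nat).
Local Notation kd i j := ((i == j)%:R : F).

Lemma kdC (i j : 'I_n) : kd i j = kd j i.
Proof. by rewrite eq_sym. Qed.

Lemma sum_kd (f : 'I_n -> F) b : \sum_p f p * kd p b = f b.
Proof.
rewrite (bigD1 b) //= eqxx mulr1 big1 ?addr0 // => p /negbTE ->.
by rewrite mulr0.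
Qed.

Lemma sum_kdl (f : 'I_n -> F) b : \sum_p f p * kd b p = f b.
Proof. by under eq_bigr do rewrite kdC; exact: sum_kd. Qed.

Lemma sum_kd_diag : \sum_(j < n) (j == j)%:R = n%:R :> F.
Proof. by under eq_bigr do rewrite eqxx; rewrite sumr_const card_ord. Qed.

End Kronecker.
Arguments kdC {F n}.

(** * Connections over a commutative ring with derivations *)

Section Connections.
Variables (F : comPzRingType) (n : nat).
Variable D : 'I_n -> F -> F.
Hypothesis derD : forall i f g, D i (f + g) = D i f + D i g.
Hypothesis derM : forall i f g, D i (f * g) = D i f * g + f * D i g.

Lemma der0 i : D i 0 = 0.
Proof. by apply: (@addrI _ (D i 0)); rewrite -derD !addr0. Qed.

Lemma derN i f : D i (- f) = - D i f.
Proof. by apply: (@addrI _ (D i f)); rewrite -derD !subrr der0. Qed.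

Lemma derB i f g : D i (f - g) = D i f - D i g.
Proof. by rewrite derD derN. Qed.

Lemma der1 i : D i 1 = 0.
Proof.
by have /eqP := derM i 1 1; rewrite !mulr1 mul1r addrC -subr_eq subrr eq_sym => /eqP.
Qed.

Lemma der_nat i k : D i k%:R = 0.
Proof. by elim: k => [|k IH]; rewrite ?der0 // mulrS derD IH der1 addr0. Qed.

Lemma der_sum i (I : Type) (r : seq I) (P : pred I) (f : I -> F) :
  D i (\sum_(k <- r | P k) f k) = \sum_(k <- r | P k) D i (f k).
Proof. exact: (big_morph (D i) (derD i) (der0 i)). Qed.

Variable om : 'I_n -> 'I_n -> 'I_n -> F.
(** For a torsion-free connection these are the components of [e_i, e_j]. *)
Definition struct_coef i j p := om i p j - om j p i.
Local Notation c := struct_coef.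

(** A covariant differentiation of arrays indexed by [J].  Allowing any index
    type makes the passage from rank k to rank k + 1 a single construction,
    [lift_connection], so that curvature has to be computed only once. *)
Record connection (J : Type) := Connection {
  cov :> 'I_n -> (J -> F) -> J -> F ;
  covD : forall i S T, cov i (fun a => S a + T a) = (fun a => cov i S a + cov i T a) ;
  covZ : forall i f T, cov i (fun a => f * T a) = (fun a => D i f * T a + f * cov i T a)
}.

Section Theory.
Variables (J : Type) (L : connection J).

Lemma cov0 i : L i (fun _ => 0) = (fun _ => 0).
Proof.
have -> : (fun _ : J => 0 : F) = (fun a => 0 * (fun _ => 0) a) by apply: funext => a; rewrite mul0r.
by rewrite covZ der0; apply: funext => a; rewrite !mul0r addr0.
Qed.

Lemma covN i T : L i (fun a => - T a) = (fun a => - L i T a).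
Proof.
apply: funext => a; apply: (@addrI _ (L i T a)).
rewrite subrr -[LHS]/((fun a => L i T a + L i (fun a => - T a) a) a) -covD.
have -> : (fun a => T a - T a) = (fun _ => 0) by apply: funext => b; rewrite subrr.
by rewrite cov0.
Qed.

Lemma covB i S T : L i (fun a => S a - T a) = (fun a => L i S a - L i T a).
Proof. by rewrite covD covN. Qed.

Lemma cov_sum i m (T : 'I_m -> J -> F) :
  L i (fun a => \sum_p T p a) = (fun a => \sum_p L i (T p) a).
Proof.
elim: m T => [|m IH] T.
  rewrite -[RHS]/(fun a => _); have E (S : 'I_0 -> J -> F) : (fun a => \sum_p S p a) = (fun _ => 0).
    by apply: funext => a; rewrite big_ord0.
  by rewrite !E cov0.
have -> : (fun a => \sum_p T p a) = (fun a => T ord0 a + (fun a => \sum_p T (lift ord0 p) a) a).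
  by apply: funext => a; rewrite big_ord_recl.
by rewrite covD IH; apply: funext => a; rewrite big_ord_recl.
Qed.

(** The last sum is the derivative along [e_i, e_j]. *)
Definition curv i j T a := L i (L j T) a - L j (L i T) a - \sum_p c i j p * L p T a.

End Theory.

Definition scalar_connection : connection unit.
Proof.
exists (fun i T a => D i (T a)) => [i S T|i f T]; apply: funext => a.
  exact: derD.
exact: derM.
Defined.

Definition slice J (T : 'I_n * J -> F) a : J -> F := fun b => T (a, b).

(** Adds one tensor index, differentiated by [om].  Vectors and covectors have
    the same components in an orthonormal frame, so no variance is recorded. *)
Definition lift_connection J (L : connection J) : connection ('I_n * J).
Proof.
exists (fun i T ab => L i (slice T ab.1) ab.2 + \sum_p om i ab.1 p * T (p, ab.2)).
  move=> i S T; apply: funext => -[a b] /=.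
  rewrite /slice covD; under eq_bigr do rewrite mulrDr.
  by rewrite big_split /=; ring.
move=> i f T; apply: funext => -[a b] /=.
rewrite /slice covZ mulrDr mulr_sumr -!addrA; congr (_ + (_ + _)).
by apply: eq_bigr => p _; ring.
Defined.

(** Cartan structure equation; this is <R(e_i, e_j) e_b, e_a>. *)
Definition frame_riem i j a b := D i (om j a b) - D j (om i a b)
  + \sum_p (om i a p * om j p b - om j a p * om i p b) - \sum_p c i j p * om p a b.

(** Mixed terms, where the two derivatives act on different indices, are
    symmetric in the two directions and drop out of the commutator.  Hence the
    curvature of a tensor is a sum of one curvature term for each index. *)
Lemma curv_lift J (L : connection J) i j T a b :
  curv (lift_connection L) i j T (a, b) =
  curv L i j (slice T a) b + \sum_p frame_riem i j a p * T (p, b).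
Proof.
have LL k l : lift_connection L k (lift_connection L l T) (a, b) =
   L k (L l (slice T a)) b + \sum_p (D k (om l a p) * T (p, b) +
     (om l a p * L k (slice T p) b + om k a p * L l (slice T p) b)) +
     \sum_p \sum_q om k a q * om l q p * T (p, b).
  rewrite /= /slice /= covD cov_sum; under [X in _ + X + _]eq_bigr do rewrite covZ.
  under [X in _ + X = _]eq_bigr => q _ do rewrite mulrDr mulr_sumr.
  rewrite !big_split /= [X in _ = _ + X]exchange_big /=.
  by under [X in _ = _ + X]eq_bigr => q _ do under eq_bigr => p _ do rewrite -mulrA; ring.
rewrite /curv !LL /=; under [X in _ - X = _]eq_bigr => q _ do rewrite mulrDr mulr_sumr.
rewrite /frame_riem; under [X in _ = _ + X]eq_bigr => p _ do
  rewrite !mulrDl !mulNr !mulr_suml.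
under [X in _ = _ + X]eq_bigr => p _ do under [X in _ + X - _]eq_bigr =>
    q _ do rewrite mulrDl mulNr.
under [X in _ = _ + X]eq_bigr => p _ do rewrite sumrB.
rewrite !big_split /= !sumrN [X in _ - (_ + X) = _]exchange_big /=.
under [X in _ - (_ + X) = _]eq_bigr => p _ do under eq_bigr => q _ do rewrite mulrA.
ring.
Qed.

Definition jacobiator m i j q := D m (c i j q) + \sum_p c i j p * c m p q.
Hypothesis jacobi : forall m i j q, jacobiator m i j q + jacobiator i j m q
    + jacobiator j m i q = 0.
Hypothesis om_anti : forall i a p, om i a p = - om i p a.

Section ConnBianchi.
Variables (J : Type) (L : connection J).

(** The covariant derivative of the curvature operator along e_m, up to the
    terms in which e_m differentiates the two form indices; the last sum is what
    remains of those terms after a cyclic summation. *)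
Definition curv_defect m i j T a :=
  L m (curv L i j T) a - curv L i j (L m T) a + \sum_p c i j p * curv L m p T a.

Lemma curv_defectE m i j T a : curv_defect m i j T a =
  (L m (L i (L j T)) a - L m (L j (L i T)) a - L i (L j (L m T)) a + L j (L i (L m T)) a)
  - \sum_q jacobiator m i j q * L q T a.
Proof.
have E1 : L m (curv L i j T) a = L m (L i (L j T)) a - L m (L j (L i T)) a
   - (\sum_p D m (c i j p) * L p T a + \sum_p c i j p * L m (L p T) a).
  rewrite /curv !covB cov_sum; under eq_bigr do rewrite covZ.
  by rewrite big_split.
rewrite /curv_defect E1 /curv.
under [X in _ - _ + X = _]eq_bigr => p _ do rewrite !mulrBr mulr_sumr.
rewrite !sumrB exchange_big /= /jacobiator.
under [X in _ = _ - X]eq_bigr => q _ do rewrite mulrDl mulr_suml.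
under [X in _ - _ + (_ - X) = _]eq_bigr => q _ do under eq_bigr => p _ do rewrite mulrA.
rewrite !big_split /=; ring.
Qed.

(** Jacobi identity for the operators [L m], [L i], [L j]: this is the second
    Bianchi identity in operator form. *)
Lemma curv_defect_cyclic m i j T a :
  curv_defect m i j T a + curv_defect i j m T a + curv_defect j m i T a = 0.
Proof.
rewrite !curv_defectE.
have -> : \sum_q jacobiator j m i q * L q T a =
    - \sum_q jacobiator m i j q * L q T a - \sum_q jacobiator i j m q * L q T a.
  rewrite -sumrN -sumrB; apply: eq_bigr => q _; have := jacobi m i j q.
  by move/(congr1 (fun x => x * L q T a)); rewrite mul0r !mulrDl => /eqP;
      rewrite addrC addr_eq0 => /eqP ->; ring.
ring.
Qed.
End ConnBianchi.

Definition cov1 i (T : 'I_n -> F) a := D i (T a) + \sum_p om i a p * T p.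
Definition cov2 i (T : 'I_n -> 'I_n -> F) a b :=
  D i (T a b) + \sum_p om i a p * T p b + \sum_p om i b p * T a p.
Definition cov4 i (T : 'I_n -> 'I_n -> 'I_n -> 'I_n -> F) a b d e :=
  D i (T a b d e) + \sum_p om i a p * T p b d e + \sum_p om i b p * T a p d e
  + \sum_p om i d p * T a b p e + \sum_p om i e p * T a b d p.

Lemma frame_riem_antil i j a b : frame_riem i j a b = - frame_riem j i a b.
Proof.
have E1 : \sum_p (om i a p * om j p b - om j a p * om i p b)
   = - \sum_p (om j a p * om i p b - om i a p * om j p b).
  by rewrite -sumrN; apply: eq_bigr => p _; ring.
have E2 : \sum_p c i j p * om p a b = - \sum_p c j i p * om p a b.
  by rewrite -sumrN; apply: eq_bigr => p _; rewrite /struct_coef; ring.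
by rewrite /frame_riem E1 E2; ring.
Qed.

Lemma frame_riem_antir i j a b : frame_riem i j a b = - frame_riem i j b a.
Proof.
rewrite /frame_riem (om_anti j a b) (om_anti i a b) !derN.
have -> : \sum_p c i j p * om p a b = - \sum_p c i j p * om p b a.
  by rewrite -sumrN; apply: eq_bigr => p _; rewrite (om_anti p a b); ring.
have -> : \sum_p (om i a p * om j p b - om j a p * om i p b)
   = - \sum_p (om i b p * om j p a - om j b p * om i p a).
  rewrite -sumrN; apply: eq_bigr => p _.
  rewrite (om_anti i a p) (om_anti j a p) (om_anti i b p) (om_anti j b p); ring.
ring.
Qed.

(** Since the torsion vanishes, the derivatives of [om] in this sum combine
    into derivatives of the structure coefficients, and the identity becomes the
    Jacobi identity. *)
Lemma frame_riem_bianchi1 i j l a : frame_riem i j a l + frame_riem j l a i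
    + frame_riem l i a j = 0.
Proof.
have := jacobi i j l a; rewrite /jacobiator /frame_riem.
set X := D i _ + _ + _ + _ => X0.
pose S u v w := \sum_p (om u a p * om v p w - om v a p * om u p w).
pose Q u v w := \sum_p c u v p * om p a w.
pose P u v w := \sum_p c v w p * c u p a.
have E : S i j l - Q i j l + (S j l i - Q j l i) + (S l i j - Q l i j) =
    P i j l + P j l i + P l i j.
  rewrite /S /Q /P -!sumrB -!big_split /=; apply: eq_bigr => p _; rewrite /struct_coef; ring.
rewrite -[RHS]X0 /X; move: E; rewrite /S /Q /P /struct_coef !derB => E.
apply/eqP; rewrite -subr_eq0; apply/eqP.
move/eqP: E; rewrite -subr_eq0 => /eqP E; rewrite -[RHS]E; ring.
Qed.

Hypothesis der_comm : forall i j f, D i (D j f) - D j (D i f) = \sum_p c i j p * D p f.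

Lemma curv_scalar i j T a : curv scalar_connection i j T a = 0.
Proof. by rewrite /curv /= der_comm subrr. Qed.

(** [curv_defect_cyclic] evaluated on the frame fields, which have constant
    components; skewness of [om] turns the torsion terms into the derivatives of
    the two form indices. *)
Lemma frame_riem_bianchi2 m i j a b :
  cov4 m frame_riem i j a b + cov4 i frame_riem j m a b + cov4 j frame_riem m i a b = 0.
Proof.
(* T is the frame field e_b: constant components, derivatives om m . b *)
pose L := lift_connection scalar_connection.
pose T : 'I_n * unit -> F := fun q => (q.1 == b)%:R.
have CT k l (S : 'I_n * unit -> F) u : curv L k l S u = \sum_p frame_riem k l u.1 p * S (p, tt).
  by case: u => u []; rewrite curv_lift curv_scalar add0r.
have CTE k l : curv L k l T = fun u => frame_riem k l u.1 b.
  by apply: funext => u; rewrite CT /= sum_kd.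
have LU k S p : L k S (p, tt) = D k (S (p, tt)) + \sum_q om k p q * S (q, tt) by [].
have LT k p : L k T (p, tt) = om k p b by rewrite LU /T der_nat add0r sum_kd.
have := curv_defect_cyclic L m i j T (a, tt).
have E x y z : curv_defect L x y z T (a, tt) =
    D x (frame_riem y z a b) + \sum_p om x a p * frame_riem y z p b
   + \sum_p om x b p * frame_riem y z a p + \sum_p c y z p * frame_riem x p a b.
  rewrite /curv_defect CTE CT LU; under [X in _ - X]eq_bigr => p _ do rewrite LT om_anti.
  congr (_ + _).
    by rewrite -sumrN; congr (_ + _); apply: eq_bigr => p _; ring.
  by apply: eq_bigr => p _; rewrite CT /= sum_kd.
rewrite !E /cov4 => H; rewrite -[RHS]H.
pose X x y z := \sum_p om x y p * frame_riem p z a b.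
pose Y x y z := \sum_p om x z p * frame_riem y p a b.
pose Z x y z := \sum_p c y z p * frame_riem x p a b.
have E2 : X m i j + Y m i j + (X i j m + Y i j m) + (X j m i + Y j m i) =
    Z m i j + Z i j m + Z j m i.
  rewrite /X /Y /Z -!big_split; apply: eq_bigr => p _ /=; rewrite /struct_coef.
  rewrite (frame_riem_antil p i) (frame_riem_antil p j) (frame_riem_antil p m).
  rewrite (om_anti i p j) (om_anti j p i) (om_anti i p m) (om_anti m p i) (om_anti j p m)
      (om_anti m p j).
  ring.
apply/eqP; rewrite -subr_eq0; apply/eqP.
move/eqP: E2; rewrite -subr_eq0 => /eqP E2; rewrite -[RHS]E2 /X /Y /Z; ring.
Qed.

(** Ricci identity: four applications of [curv_lift], starting from scalars,
    on which the curvature vanishes as there is no torsion. *)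
Lemma cov4_comm i j T a b d e :
  cov4 i (cov4 j T) a b d e - cov4 j (cov4 i T) a b d e - \sum_p c i j p * cov4 p T a b d e =
  \sum_p frame_riem i j a p * T p b d e + \sum_p frame_riem i j b p * T a p d e
  + \sum_p frame_riem i j d p * T a b p e + \sum_p frame_riem i j e p * T a b d p.
Proof.
pose L := lift_connection (lift_connection (lift_connection (lift_connection scalar_connection))).
pose U (T : 'I_n -> 'I_n -> 'I_n -> 'I_n -> F) : _ -> F := fun u :
    'I_n * ('I_n * ('I_n * ('I_n * unit))) =>
   T u.1 u.2.1 u.2.2.1 u.2.2.2.1.
have LE k S : L k (U S) = U (cov4 k S).
  apply: funext => -[x [y [z [t []]]]]; rewrite /L /U /= /slice /= /cov4; ring.
have := @curv_lift _ (lift_connection (lift_connection (lift_connection scalar_connection)))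
  i j (U T) a (b, (d, (e, tt))).
rewrite [LHS]/curv -/L !LE; under eq_bigr do rewrite LE.
by rewrite !curv_lift curv_scalar /U /slice /= => ->; ring.
Qed.

End Connections.

(** * Algebraic curvature tensors and their contractions *)

Section CurvatureArrays.
Variables (F : comPzRingType) (n : nat).
Hypothesis torsion_free : forall k (a : F), k.+1%:R * a = 0 -> a = 0.
Local Notation array2 := ('I_n -> 'I_n -> F).
Local Notation array4 := ('I_n -> 'I_n -> 'I_n -> 'I_n -> F).
Local Notation kd i j := ((i == j)%:R : F).

Lemma double_eq (a b : F) : 2 * a = 2 * b -> a = b.
Proof.
move/eqP; rewrite -subr_eq0 -mulrBr => /eqP /torsion_free /eqP.
by rewrite subr_eq0 => /eqP.
Qed.

Lemma sum_anti2 (a b : array2) : (forall k l, a k l = - a l k) ->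
  2 * (\sum_k \sum_l a k l * b k l) = \sum_k \sum_l a k l * (b k l - b l k).
Proof.
move=> Ha; under [RHS]eq_bigr do (under eq_bigr do rewrite mulrBr; rewrite sumrB).
rewrite sumrB [X in _ = _ - X]exchange_big /=.
under [X in _ = _ - X]eq_bigr => l _ do (under eq_bigr => k _ do rewrite Ha mulNr; rewrite sumrN).
by rewrite sumrN opprK mulr_natl mulr2n.
Qed.

Definition curvature_like (T : array4) :=
  [/\ forall i j k l, T i j k l = - T j i k l,
      forall i j k l, T i j k l = - T i j l k &
      forall i j k l, T i j k l + T j k i l + T k i j l = 0].

(** The alternating sum of the first Bianchi identities at the four cyclic
    shifts of (i, j, k, l) is twice the difference of the two sides. *)
Lemma pair_sym T : curvature_like T -> forall i j k l, T i j k l = T k l i j.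
Proof.
move=> [al ar b1] i j k l; apply: double_eq.
have H2 : T j k i l + T k l i j + T j l k i = 0.
  by rewrite -[RHS]oppr0 -(b1 j k l i) (ar j k i) (ar k l i) (al j l); ring.
have H3 : T k l i j + T i l j k + T k i j l = 0.
  by rewrite -[RHS](b1 k l i j) (al l i) (ar i l k j) (al i k) (ar k i l j); ring.
have H4 : T i l j k + T i j k l + T j l k i = 0.
  by rewrite -[RHS]oppr0 -(b1 l i j k) (al i l) (ar i j k) (ar j l k); ring.
transitivity (2 * T k l i j + ((T i j k l + T j k i l + T k i j l)
   - (T j k i l + T k l i j + T j l k i) - (T k l i j + T i l j k + T k i j l)
   + (T i l j k + T i j k l + T j l k i))); first by ring.
by rewrite b1 H2 H3 H4; ring.
Qed.

(** Kulkarni-Nomizu product of [A] with the metric in an orthonormal frame. *)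
Definition KN_delta (A : array2) : array4 := fun i j k l =>
  A i k * kd j l + kd i k * A j l - A i l * kd j k - kd i l * A j k.

Lemma KN_delta_swap A i j k l : KN_delta A i j k l = KN_delta A j i l k.
Proof. by rewrite /KN_delta; ring. Qed.

Lemma KN_delta_curvature_like A : (forall i j, A i j = A j i) -> curvature_like (KN_delta A).
Proof.
move=> As; split=> i j k l; rewrite /KN_delta; first by ring.
  by ring.
rewrite (kdC i j) (kdC i k) (kdC j k) (As i j) (As i k) (As j k); ring.
Qed.

Lemma KN_delta_contract A (f : 'I_n -> F) b d e :
  \sum_p f p * KN_delta A p b d e = (\sum_p f p * A p d) * kd b e + f d * A b e
    - (\sum_p f p * A p e) * kd b d - f e * A b d.
Proof.
rewrite -(sum_kd (fun p => f p * A b e) d) -(sum_kd (fun p => f p * A b d) e) !mulr_suml.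
rewrite -big_split -!sumrB /=; apply: eq_bigr => p _; rewrite /KN_delta.
ring.
Qed.

(** Twice the square W^2, which avoids a division by two in the ring. *)
Definition sq2 (T : array4) : array4 := fun i j k l => \sum_p \sum_q T i j p q * T k l p q.
Definition sharp (T : array4) : array4 := fun i j k l =>
  \sum_p \sum_q (T i p k q * T j p l q - T i p l q * T j p k q).
Definition dot4 (S T : array4) := \sum_i \sum_j \sum_k \sum_l S i j k l * T i j k l.
Definition gram_left (T : array4) : array2 := fun i p => \sum_j \sum_k \sum_l T i j k l * T p j k l.
Definition ricci (T : array4) : array2 := fun i k => \sum_j T i j k j.
Definition dot2 (S T : array2) := \sum_i \sum_j S i j * T i j.

(** The value of the sum over m of [nabla_m, nabla_i] W_mjkl that the Ricci
    identity gives: the curvature acts on each index of W in turn. *)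
Definition ricci_terms (Rm W : array4) : array4 := fun i j k l =>
  \sum_m (\sum_p Rm m i m p * W p j k l + \sum_p Rm m i j p * W m p k l
        + \sum_p Rm m i k p * W m j p l + \sum_p Rm m i l p * W m j k p).

Lemma dot4_eq S T S' T' : (forall i j k l, S i j k l * T i j k l = S' i j k l * T' i j k l) ->
  dot4 S T = dot4 S' T'.
Proof. by move=> H; do 4! (apply: eq_bigr => ? _). Qed.

Lemma dot4D S T T' : dot4 S (fun i j k l => T i j k l + T' i j k l) = dot4 S T + dot4 S T'.
Proof.
rewrite /dot4 -big_split; apply: eq_bigr => i _ /=.
rewrite -big_split; apply: eq_bigr => j _ /=.
rewrite -big_split; apply: eq_bigr => k _ /=.
by rewrite -big_split; apply: eq_bigr => l _ /=; rewrite mulrDr.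
Qed.

Lemma dot4N S T : dot4 S (fun i j k l => - T i j k l) = - dot4 S T.
Proof.
rewrite /dot4 -sumrN; apply: eq_bigr => i _.
rewrite -sumrN; apply: eq_bigr => j _.
rewrite -sumrN; apply: eq_bigr => k _.
by rewrite -sumrN; apply: eq_bigr => l _; rewrite mulrN.
Qed.

Lemma dot4_sumr S (f : 'I_n -> F) (T : 'I_n -> array4) :
  dot4 S (fun i j k l => \sum_m f m * T m i j k l) = \sum_m f m * dot4 S (T m).
Proof.
rewrite /dot4; do 4! (under [RHS]eq_bigr do rewrite mulr_sumr;
  rewrite [RHS]exchange_big; apply: eq_bigr => ? _ /=).
by rewrite mulr_sumr; apply: eq_bigr => m _; rewrite mulrCA.
Qed.

Lemma dot4C S T : dot4 S T = dot4 T S.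
Proof. by do 4! (apply: eq_bigr => ? _); rewrite mulrC. Qed.

Lemma dot4_swap12 S T : dot4 S T = dot4 (fun i j k l => S j i k l) (fun i j k l => T j i k l).
Proof. by rewrite /dot4 exchange_big. Qed.

Lemma dot4_swap34 S T : dot4 S T = dot4 (fun i j k l => S i j l k) (fun i j k l => T i j l k).
Proof. by rewrite /dot4; do 2! (apply: eq_bigr => ? _); rewrite exchange_big. Qed.

Section Contraction.
Variables (W : array4) (A : array2).
Hypothesis Wcl : curvature_like W.
Hypothesis Wtf : forall i k, \sum_j W i j k j = 0.
Hypothesis As : forall i j, A i j = A j i.
Let Wal : forall i j k l, W i j k l = - W j i k l. Proof. by case: Wcl. Qed.
Let War : forall i j k l, W i j k l = - W i j l k. Proof. by case: Wcl. Qed.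
Let Wb : forall i j k l, W i j k l + W j k i l + W k i j l = 0. Proof. by case: Wcl. Qed.
Let Wp := pair_sym Wcl.

Lemma W_diag i k l : W i i k l = 0.
Proof.
apply: double_eq; rewrite mulr0 mulr_natl mulr2n.
by rewrite {1}Wal addNr.
Qed.

(** The two partial contractions of W with itself that meet the curvature in
    [ricci_terms]: [gram_pair] when the free indices of each factor form an
    antisymmetric pair, [gram_cross] otherwise. *)
Definition gram_cross (i k m p : 'I_n) := \sum_j \sum_l W i j k l * W m j p l.
Definition gram_pair (i j m p : 'I_n) := \sum_k \sum_l W i j k l * W m p k l.

Lemma bianchi_right i j k l : W i j k l + W i k l j + W i l j k = 0.
Proof. by rewrite -[RHS](Wb k l i j) (Wp i j) (Wal l i k j) (War i l k j); ring. Qed.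

(** The form in which the first Bianchi identity enters the contractions:
    antisymmetrising W_ilkj in l and k gives back W. *)
Lemma bianchi_swap i j k l : W i l k j - W i k l j = W i j k l.
Proof.
by rewrite (War i l) -[LHS]addr0 -(bianchi_right i j k l); ring.
Qed.

(** A crossed contraction of W with itself is half of the straight one, by
    antisymmetrising over the last two indices and [bianchi_swap]. *)
Lemma gram_cross_tr23 i p : 2 * (\sum_k gram_cross i k k p) = gram_left W i p.
Proof.
rewrite /gram_cross /gram_left exchange_big mulr_sumr /=; apply: eq_bigr => j _.
rewrite (sum_anti2 (fun k l => W k j p l)); last by move=> k l; exact: War.
apply: eq_bigr => k _; apply: eq_bigr => l _; congr (_ * _).
by rewrite -[RHS]bianchi_swap (Wp k j) (Wp l j).
Qed.

Lemma gram_cross_sym i k m p : gram_cross i k m p = gram_cross k i p m.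
Proof.
rewrite /gram_cross exchange_big /=; do 2! (apply: eq_bigr => ? _).
by congr (_ * _); exact: Wp.
Qed.

Lemma gram_cross_tr14 k m : 2 * (\sum_i gram_cross i k m i) = gram_left W k m.
Proof.
rewrite -gram_cross_tr23; congr (2 * _); apply: eq_bigr => i _; exact: gram_cross_sym.
Qed.

(** This trace and the next one contain a trace of W. *)
Lemma gram_cross_tr12 m p : \sum_i gram_cross i i m p = 0.
Proof.
rewrite /gram_cross exchange_big big1 // => j _ /=.
rewrite exchange_big big1 // => l _ /=.
rewrite -mulr_suml (eq_bigr (fun i => W j i l i)) ?Wtf ?mul0r // => i _.
by rewrite Wal War opprK.
Qed.

Lemma gram_cross_tr34 i k : \sum_m gram_cross i k m m = 0.
Proof.
rewrite /gram_cross exchange_big big1 // => j _ /=.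
rewrite exchange_big big1 // => l _ /=.
rewrite -mulr_sumr (eq_bigr (fun i => W j i l i)) ?Wtf ?mulr0 // => m _.
by rewrite Wal War opprK.
Qed.

Lemma KN_delta_mixed (H : array4) m i k :
  \sum_p KN_delta A m i k p * H i k m p = (\sum_p H i k m p * A p i) * kd k m
   + H i k m i * A k m - (\sum_p H i k m p * A p m) * kd k i - H i k m m * A k i.
Proof.
rewrite -(KN_delta_contract A (H i k m) k i m); apply: eq_bigr => p _.
by rewrite mulrC /KN_delta (As m k) (As i p) (As m p) (As i k) (kdC i p) (kdC m k) (kdC i k)
    (kdC m p); ring.
Qed.

(** Contracting A o g leaves four partial traces of [H]; in both applications
    two of them vanish and the other two are multiples of [gram_left W]. *)
Lemma KN_delta_mixed_sum (H : array4) (t1 t2 : array2) :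
    (forall i p, \sum_k H i k k p = t1 i p) -> (forall k m, \sum_i H i k m i = t2 k m) ->
    (forall m p, \sum_i H i i m p = 0) -> (forall i k, \sum_m H i k m m = 0) ->
  \sum_i \sum_k \sum_m \sum_p KN_delta A m i k p * H i k m p = dot2 A t1 + dot2 A t2.
Proof.
move=> h1 h2 h3 h4.
under eq_bigr do under eq_bigr do under eq_bigr do rewrite KN_delta_mixed.
transitivity (\sum_i \sum_k \sum_m (\sum_p H i k m p * A p i) * kd m k
  + \sum_i \sum_k \sum_m H i k m i * A k m
  - \sum_i \sum_k \sum_m (\sum_p H i k m p * A p m) * kd k i
  - \sum_i \sum_k \sum_m H i k m m * A k i).
  rewrite -big_split -!sumrB /=; apply: eq_bigr => i _.
  rewrite -big_split -!sumrB /=; apply: eq_bigr => k _.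
  rewrite -big_split -!sumrB /=; apply: eq_bigr => m _.
  by rewrite (kdC k m).
have -> : \sum_i \sum_k \sum_m (\sum_p H i k m p * A p i) * kd m k = dot2 A t1.
  apply: eq_bigr => i _; under eq_bigr do rewrite sum_kd.
  rewrite exchange_big; apply: eq_bigr => p _ /=.
  by rewrite -mulr_suml h1 mulrC As.
have -> : \sum_i \sum_k \sum_m H i k m i * A k m = dot2 A t2.
  rewrite exchange_big; apply: eq_bigr => k _ /=.
  rewrite exchange_big; apply: eq_bigr => m _ /=.
  by rewrite -mulr_suml h2 mulrC.
have -> : \sum_i \sum_k \sum_m (\sum_p H i k m p * A p m) * kd k i = 0.
  under eq_bigr do (under eq_bigr do rewrite -mulr_suml; rewrite sum_kd).
  rewrite exchange_big big1 // => m _ /=; rewrite exchange_big big1 // => p _ /=.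
  by rewrite -mulr_suml h3 mul0r.
have -> : \sum_i \sum_k \sum_m H i k m m * A k i = 0.
  by rewrite big1 // => i _; rewrite big1 // => k _; rewrite -mulr_suml h4 mul0r.
by rewrite !subr0.
Qed.

Lemma dot2Z (S T : array2) a : a * dot2 S T = dot2 S (fun i j => a * T i j).
Proof.
rewrite /dot2 mulr_sumr; apply: eq_bigr => i _.
by rewrite mulr_sumr; apply: eq_bigr => j _; rewrite mulrCA.
Qed.

Lemma dot2_eq (S T T' : array2) : (forall i j, T i j = T' i j) -> dot2 S T = dot2 S T'.
Proof. by move=> H; do 2! (apply: eq_bigr => ? _); rewrite H. Qed.

Lemma KN_delta_gram_cross : 2 * (\sum_i \sum_k \sum_m \sum_p KN_delta A m i k p * gram_cross i k m p)
  = 2 * dot2 A (gram_left W).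
Proof.
rewrite (KN_delta_mixed_sum (fun _ _ => erefl) (fun _ _ => erefl) gram_cross_tr12 gram_cross_tr34).
rewrite mulrDr !dot2Z (dot2_eq _ gram_cross_tr23) (dot2_eq _ gram_cross_tr14).
by rewrite -dot2Z mulr_natl mulr2n.
Qed.

(** This cancels twice the sum in [KN_delta_gram_cross], which is why only the
    traced curvature term contributes Ricci curvature to the final formula. *)
Lemma KN_delta_gram_pair : \sum_i \sum_j \sum_m \sum_p KN_delta A m i j p * gram_pair i j m p
  = - 2 * dot2 A (gram_left W).
Proof.
have h1 i p : \sum_k gram_pair i k k p = - 1 * gram_left W i p.
  rewrite mulr_sumr; apply: eq_bigr => j _; rewrite mulr_sumr; apply: eq_bigr => k _.
  rewrite mulr_sumr; apply: eq_bigr => l _; rewrite (Wal j p); ring.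
have h2 k m : \sum_i gram_pair i k m i = - 1 * gram_left W k m.
  rewrite mulr_sumr; apply: eq_bigr => j _; rewrite mulr_sumr; apply: eq_bigr => a _.
  rewrite mulr_sumr; apply: eq_bigr => l _; rewrite (Wal j k); ring.
rewrite (KN_delta_mixed_sum h1 h2).
- by rewrite -dot2Z; ring.
- move=> m p; rewrite big1 // => i _; rewrite /gram_pair big1 // => k _.
  by rewrite big1 // => l _; rewrite W_diag mul0r.
- move=> m p; rewrite big1 // => i _; rewrite /gram_pair big1 // => k _.
  by rewrite big1 // => l _; rewrite W_diag mulr0.
Qed.

Variable Rm : array4.
Hypothesis Rm_dec : forall i j k l, Rm i j k l = W i j k l + KN_delta A i j k l.

Lemma dot4_ricci_trace : dot4 W (fun i j k l => \sum_m \sum_p Rm m i m p * W p j k l) =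
  dot2 (ricci Rm) (gram_left W).
Proof.
have Rcl i j k l : Rm i j k l = Rm j i l k.
  by rewrite !Rm_dec Wal War opprK KN_delta_swap.
rewrite /dot4 /dot2; apply: eq_bigr => i _.
transitivity (\sum_j \sum_k \sum_l \sum_p W i j k l * (ricci Rm i p * W p j k l)).
  do 3! (apply: eq_bigr => ? _); rewrite -mulr_sumr; congr (_ * _).
  rewrite exchange_big; apply: eq_bigr => p _ /=; rewrite -mulr_suml; congr (_ * _).
  by apply: eq_bigr => m _.
under eq_bigr do under eq_bigr do rewrite exchange_big /=.
under eq_bigr do rewrite exchange_big /=.
rewrite exchange_big /=; apply: eq_bigr => p _.
rewrite /gram_left !mulr_sumr; apply: eq_bigr => j _.
rewrite !mulr_sumr; apply: eq_bigr => k _.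
by rewrite !mulr_sumr; apply: eq_bigr => l _; rewrite mulrCA.
Qed.

Lemma dot4_gram_pair (S : array4) : dot4 W (fun i j k l => \sum_m \sum_p S m i j p * W m p k l) =
  \sum_i \sum_j \sum_m \sum_p S m i j p * gram_pair i j m p.
Proof.
do 2! (apply: eq_bigr => ? _).
under eq_bigr do under eq_bigr do rewrite mulr_sumr.
under eq_bigr do rewrite exchange_big /=.
rewrite exchange_big /=; apply: eq_bigr => m _.
under eq_bigr do under eq_bigr do rewrite mulr_sumr.
under eq_bigr do rewrite exchange_big /=.
rewrite exchange_big /=; apply: eq_bigr => p _.
rewrite mulr_sumr; apply: eq_bigr => k _.
by rewrite mulr_sumr; apply: eq_bigr => l _; rewrite mulrCA.
Qed.

Lemma dot4_gram_cross (S : array4) : dot4 W (fun i j k l => \sum_m \sum_p S m i k p * W m j p l) =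
  \sum_i \sum_k \sum_m \sum_p S m i k p * gram_cross i k m p.
Proof.
apply: eq_bigr => i _; rewrite exchange_big; apply: eq_bigr => k _ /=.
under eq_bigr do under eq_bigr do rewrite mulr_sumr.
under eq_bigr do rewrite exchange_big /=.
rewrite exchange_big /=; apply: eq_bigr => m _.
under eq_bigr do under eq_bigr do rewrite mulr_sumr.
under eq_bigr do rewrite exchange_big /=.
rewrite exchange_big /=; apply: eq_bigr => p _.
rewrite mulr_sumr; apply: eq_bigr => j _.
by rewrite mulr_sumr; apply: eq_bigr => l _; rewrite mulrCA.
Qed.

(** The terms with the curvature on the third and on the fourth index agree
    after exchanging k and l, as W is skew in these indices. *)
Lemma dot4_ricci_terms_split : dot4 W (ricci_terms Rm W) =
  dot2 (ricci Rm) (gram_left W)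
  + dot4 W (fun i j k l => \sum_m \sum_p Rm m i j p * W m p k l)
  + 2 * dot4 W (fun i j k l => \sum_m \sum_p Rm m i k p * W m j p l).
Proof.
have -> : 2 * dot4 W (fun i j k l => \sum_m \sum_p Rm m i k p * W m j p l) =
  dot4 W (fun i j k l => \sum_m \sum_p Rm m i k p * W m j p l) +
  dot4 W (fun i j k l => \sum_m \sum_p Rm m i l p * W m j k p).
  rewrite mulr_natl mulr2n; congr (_ + _); rewrite dot4_swap34; apply: dot4_eq => i j k l.
  rewrite (War i j l k) mulNr -mulrN -sumrN; congr (_ * _); apply: eq_bigr => m _.
  by rewrite -sumrN; apply: eq_bigr => p _; rewrite (War m j p k) mulrN opprK.
rewrite addrA -dot4_ricci_trace -!dot4D; apply: dot4_eq => i j k l; congr (_ * _).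
by rewrite /ricci_terms !big_split.
Qed.

(** Antisymmetrise over m and p, where W_mpkl is skew, and apply
    [bianchi_swap]. *)
Lemma dot4_sq2_cubic : 2 * dot4 W (fun i j k l => \sum_m \sum_p W m i j p * W m p k l) =
  - dot4 W (sq2 W).
Proof.
rewrite -dot4N /dot4 mulr_sumr; apply: eq_bigr => i _.
rewrite mulr_sumr; apply: eq_bigr => j _; rewrite mulr_sumr; apply: eq_bigr => k _.
rewrite mulr_sumr; apply: eq_bigr => l _; rewrite mulrCA; congr (_ * _).
under eq_bigr do under eq_bigr do rewrite mulrC.
rewrite (sum_anti2 (fun m p => W m i j p)); last by move=> m p; exact: Wal.
rewrite /sq2 -sumrN; apply: eq_bigr => m _; rewrite -sumrN; apply: eq_bigr => p _.
rewrite (Wp k l m p) -(bianchi_swap i j m p) (Wal m i) (Wal p i) (War i m j p) (War i p j m); ring.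
Qed.

Lemma dot4_sharp_cubic : 2 * dot4 W (fun i j k l => \sum_m \sum_p W m i k p * W m j p l) =
  - dot4 W (sharp W).
Proof.
have E : dot4 W (sharp W) = 2 * dot4 W (fun i j k l => \sum_p \sum_q W i p k q * W j p l q).
  have -> : dot4 W (sharp W) = dot4 W (fun i j k l => \sum_p \sum_q W i p k q * W j p l q)
     + dot4 W (fun i j k l => - \sum_p \sum_q W i p l q * W j p k q).
    rewrite -dot4D; apply: dot4_eq => i j k l; congr (_ * _); rewrite /sharp.
    by under eq_bigr do rewrite sumrB; rewrite sumrB.
  rewrite mulr_natl mulr2n; congr (_ + _); rewrite dot4_swap34.
  by apply: dot4_eq => i j k l; rewrite (War i j l k) mulrNN.
rewrite E -mulrN -dot4N; congr (2 * _); apply: dot4_eq => i j k l; congr (_ * _).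
rewrite -sumrN; apply: eq_bigr => m _; rewrite -sumrN; apply: eq_bigr => p _.
by rewrite (Wal m i) (Wal m j) (War j m p l) mulNr opprK.
Qed.

(** The four terms of the Kulkarni-Nomizu product contribute equally. *)
Lemma dot4_KN_delta_sq2 (S : array2) : dot4 (KN_delta S) (sq2 W) = 4 * dot2 S (gram_left W).
Proof.
have sl i j k l : sq2 W i j k l = - sq2 W j i k l.
  by rewrite -sumrN; apply: eq_bigr => p _; rewrite -sumrN; apply: eq_bigr => q _;
      rewrite Wal mulNr.
have sr i j k l : sq2 W i j k l = - sq2 W i j l k.
  by rewrite -sumrN; apply: eq_bigr => p _; rewrite -sumrN; apply: eq_bigr => q _;
      rewrite (Wal k) mulrN.
have B : dot4 (fun i j k l => S i k * kd j l) (sq2 W) = dot2 S (gram_left W).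
  apply: eq_bigr => i _; rewrite exchange_big; apply: eq_bigr => k _ /=.
  rewrite mulr_sumr; apply: eq_bigr => j _.
  under eq_bigr => l _ do rewrite kdC mulrAC.
  by rewrite sum_kd.
have B2 : dot4 (fun i j k l => kd i k * S j l) (sq2 W) = dot2 S (gram_left W).
  rewrite -B dot4_swap12 dot4_swap34; apply: dot4_eq => i j k l.
  by rewrite sl sr; ring.
have B3 : dot4 (fun i j k l => - (S i l * kd j k)) (sq2 W) = dot2 S (gram_left W).
  by rewrite -B dot4_swap34; apply: dot4_eq => i j k l; rewrite sr; ring.
have B4 : dot4 (fun i j k l => - (kd i l * S j k)) (sq2 W) = dot2 S (gram_left W).
  by rewrite -B dot4_swap12; apply: dot4_eq => i j k l; rewrite sl; ring.
have -> : 4 * dot2 S (gram_left W) = dot2 S (gram_left W) + dot2 S (gram_left W)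
   + dot2 S (gram_left W) + dot2 S (gram_left W) by ring.
rewrite -{1}B -{1}B2 -{1}B3 -{1}B4 !(dot4C _ (sq2 W)) -!dot4D.
by apply: dot4_eq => i j k l; rewrite /KN_delta.
Qed.

Lemma dot4_ricci_terms : 2 * dot4 W (ricci_terms Rm W) =
  2 * dot2 (ricci Rm) (gram_left W) - dot4 W (sq2 W) - 2 * dot4 W (sharp W).
Proof.
rewrite dot4_ricci_terms_split.
have -> : dot4 W (fun i j k l => \sum_m \sum_p Rm m i j p * W m p k l) =
   dot4 W (fun i j k l => \sum_m \sum_p W m i j p * W m p k l)
   - 2 * dot2 A (gram_left W).
  rewrite -mulNr -KN_delta_gram_pair -dot4_gram_pair -dot4D; apply: dot4_eq => i j k l;
      congr (_ * _).
  by rewrite -big_split; apply: eq_bigr => m _ /=; rewrite -big_split; apply: eq_bigr => p _ /=;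
    rewrite Rm_dec mulrDl.
have -> : 2 * dot4 W (fun i j k l => \sum_m \sum_p Rm m i k p * W m j p l) =
   2 * dot4 W (fun i j k l => \sum_m \sum_p W m i k p * W m j p l)
   + 2 * dot2 A (gram_left W).
  rewrite -KN_delta_gram_cross -dot4_gram_cross -mulrDr -dot4D; congr (2 * _).
  apply: dot4_eq => i j k l; congr (_ * _).
  by rewrite -big_split; apply: eq_bigr => m _ /=; rewrite -big_split; apply: eq_bigr => p _ /=;
    rewrite Rm_dec mulrDl.
rewrite dot4_sharp_cubic; move: dot4_sq2_cubic.
move=> E; rewrite -[X in _ = _ - X - _]opprK -E; ring.
Qed.

End Contraction.
End CurvatureArrays.

(** * The Bochner formula for a divergence-free Weyl tensor *)

Section Bochner.
Variables (F : comPzRingType) (n : nat).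
Hypothesis torsion_free : forall k (a : F), k.+1%:R * a = 0 -> a = 0.
Variable D : 'I_n -> F -> F.
Hypothesis derD : forall i f g, D i (f + g) = D i f + D i g.
Hypothesis derM : forall i f g, D i (f * g) = D i f * g + f * D i g.
Variable om : 'I_n -> 'I_n -> 'I_n -> F.
Hypothesis jacobi : forall m i j q,
  jacobiator D om m i j q + jacobiator D om i j m q + jacobiator D om j m i q = 0.
Hypothesis om_anti : forall i a p, om i a p = - om i p a.
Hypothesis der_comm : forall i j f,
  D i (D j f) - D j (D i f) = \sum_p struct_coef om i j p * D p f.
Local Notation array2 := ('I_n -> 'I_n -> F).
Local Notation array4 := ('I_n -> 'I_n -> 'I_n -> 'I_n -> F).
Local Notation kd i j := ((i == j)%:R : F).
Local Notation nab4 := (cov4 D om).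
Local Notation nab2 := (cov2 D om).
Local Notation Rm := (frame_riem D om).

Lemma frame_riem_curvature_like : curvature_like Rm.
Proof.
split=> [i j k l|i j k l|i j k l]; [exact: frame_riem_antil | exact: frame_riem_antir |].
rewrite (frame_riem_antir derD om_anti i j) (frame_riem_antir derD om_anti j k)
    (frame_riem_antir derD om_anti k i).
by rewrite -[RHS]oppr0 -(frame_riem_bianchi1 derD jacobi i j k l); ring.
Qed.

Lemma cov4E m (T : array4) i j k l : nab4 m T i j k l =
  D m (T i j k l) + \sum_p om m i p * T p j k l + \sum_p om m j p * T i p k l
  + \sum_p om m k p * T i j p l + \sum_p om m l p * T i j k p.
Proof. by []. Qed.

Lemma cov4_ext m (S T : array4) : (forall i j k l, S i j k l = T i j k l) ->
  forall i j k l, nab4 m S i j k l = nab4 m T i j k l.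
Proof.
move=> H i j k l; rewrite /cov4 H.
by congr (_ + _ + _ + _ + _); apply: eq_bigr => p _; rewrite H.
Qed.

Lemma sum_mulrB (f g h : 'I_n -> F) :
  \sum_p f p * (g p - h p) = \sum_p f p * g p - \sum_p f p * h p.
Proof. by rewrite -sumrB; apply: eq_bigr => p _; rewrite mulrBr. Qed.

Lemma cov4B m (S T : array4) i j k l :
  nab4 m (fun i j k l => S i j k l - T i j k l) i j k l = nab4 m S i j k l - nab4 m T i j k l.
Proof. by rewrite /cov4 (derB derD) !sum_mulrB; ring. Qed.

Lemma cov4_0 m i j k l : nab4 m (fun _ _ _ _ => 0) i j k l = 0.
Proof. by rewrite /cov4 (der0 derD) !big1 ?addr0 // => p _; rewrite mulr0. Qed.

Lemma cov4N m (T : array4) i j k l : nab4 m (fun i j k l => - T i j k l) i j k l =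
    - nab4 m T i j k l.
Proof.
rewrite -[RHS]add0r -(cov4_0 m i j k l) -cov4B.
by apply: cov4_ext => ? ? ? ?; rewrite sub0r.
Qed.

Lemma cov4_curvature_like m T : curvature_like T -> curvature_like (nab4 m T).
Proof.
move=> [al ar b]; split=> i j k l.
- rewrite (cov4_ext m al) cov4N; congr (- _); rewrite /cov4; ring.
- rewrite (cov4_ext m ar) cov4N; congr (- _); rewrite /cov4; ring.
- have E a c d e : T a c d e = - T c d a e - T d a c e.
    by rewrite -[LHS]addr0 -[in LHS]oppr0 -(b a c d e); ring.
  rewrite (cov4_ext m E) cov4B cov4N /cov4; ring.
Qed.

(** The Kronecker symbol is parallel because [om] is skew. *)
Lemma cov4_KN_delta m (A : array2) : (forall i j, A i j = A j i) ->
  forall i j k l, nab4 m (KN_delta A) i j k l = KN_delta (nab2 m A) i j k l.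
Proof.
move=> As i j k l.
rewrite /cov4.
have P := pair_sym torsion_free (KN_delta_curvature_like As).
under [X in _ + _ + X + _ + _ = _]eq_bigr do rewrite KN_delta_swap.
under [X in _ + _ + X + _ = _]eq_bigr do rewrite P.
under [X in _ + _ + X = _]eq_bigr do rewrite P KN_delta_swap.
rewrite !KN_delta_contract {1}/KN_delta !(derB derD) derD !derM !(der_nat derD derM).
have C2 a b : nab2 m A a b = D m (A a b) + \sum_p om m a p * A p b + \sum_p om m b p * A p a.
  by rewrite /cov2; congr (_ + _); apply: eq_bigr => p _; rewrite (As a p).
rewrite /KN_delta !C2.
rewrite (om_anti m k i) (om_anti m l i) (om_anti m k j) (om_anti m l j).
rewrite (kdC k i) (kdC k j) (kdC l i) (kdC l j).
rewrite (As k i) (As k j) (As l i) (As l j).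
ring.
Qed.

(** Traces commute with covariant derivatives: the two terms that
    differentiate the contracted indices cancel, [om] being skew. *)
Lemma cov4_trace m T i k :
  \sum_j nab4 m T i j k j = nab2 m (ricci T) i k.
Proof.
rewrite /cov4 /cov2 !big_split /=.
have -> : \sum_j \sum_p om m j p * T i j k p = - \sum_j \sum_p om m j p * T i p k j.
  rewrite -sumrN exchange_big; apply: eq_bigr => j _ /=.
  by rewrite -sumrN; apply: eq_bigr => p _; rewrite om_anti mulNr.
rewrite /ricci (der_sum derD).
under [X in _ = _ + X + _]eq_bigr do rewrite mulr_sumr.
under [X in _ = _ + X]eq_bigr do rewrite mulr_sumr.
rewrite [X in _ = _ + X + _]exchange_big [X in _ = _ + X]exchange_big /=; ring.
Qed.

Lemma der_dot4_aux i (S T : array4) : D i (dot4 S T) =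
  dot4 (fun a b d e => D i (S a b d e)) T + dot4 S (fun a b d e => D i (T a b d e)).
Proof.
rewrite /dot4 (der_sum derD) -big_split; apply: eq_bigr => a _ /=.
rewrite (der_sum derD) -big_split; apply: eq_bigr => b _ /=.
rewrite (der_sum derD) -big_split; apply: eq_bigr => d _ /=.
by rewrite (der_sum derD) -big_split; apply: eq_bigr => e _ /=.
Qed.

Lemma dot4_swap_pairs (S T : array4) :
  dot4 S T = dot4 (fun i j k l => S k l i j) (fun i j k l => T k l i j).
Proof.
rewrite /dot4; under eq_bigr do rewrite exchange_big /=.
rewrite exchange_big; apply: eq_bigr => k _ /=.
under eq_bigr do rewrite exchange_big /=.
by rewrite exchange_big.
Qed.

(** Infinitesimal form of the invariance of [dot4] under rotations of one
    index; the other slots reduce to this one by permuting the indices. *)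
Lemma om_skew_slot4 i (S T : array4) :
  dot4 (fun a b d e => \sum_p om i e p * S a b d p) T
  + dot4 S (fun a b d e => \sum_p om i e p * T a b d p) = 0.
Proof.
rewrite /dot4 -big_split big1 // => a _ /=.
rewrite -big_split big1 // => b _ /=; rewrite -big_split big1 // => d _ /=.
under eq_bigr do rewrite mulr_suml.
under [X in _ + X]eq_bigr do rewrite mulr_sumr.
rewrite [X in _ + X]exchange_big -big_split big1 //= => e _.
by rewrite -big_split big1 //= => p _; rewrite (om_anti i p e); ring.
Qed.

Lemma om_skew_slot3 i (S T : array4) :
  dot4 (fun a b d e => \sum_p om i d p * S a b p e) T
  + dot4 S (fun a b d e => \sum_p om i d p * T a b p e) = 0.
Proof. by rewrite dot4_swap34 [X in _ + X]dot4_swap34; exact: om_skew_slot4. Qed.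

Lemma om_skew_slot2 i (S T : array4) :
  dot4 (fun a b d e => \sum_p om i b p * S a p d e) T
  + dot4 S (fun a b d e => \sum_p om i b p * T a p d e) = 0.
Proof. by rewrite dot4_swap_pairs [X in _ + X]dot4_swap_pairs; exact: om_skew_slot4. Qed.

Lemma om_skew_slot1 i (S T : array4) :
  dot4 (fun a b d e => \sum_p om i a p * S p b d e) T
  + dot4 S (fun a b d e => \sum_p om i a p * T p b d e) = 0.
Proof. by rewrite dot4_swap_pairs [X in _ + X]dot4_swap_pairs; exact: om_skew_slot3. Qed.

(** The metric is parallel: the terms with [om] cancel in each slot. *)
Lemma der_dot4 i (S T : array4) : D i (dot4 S T) = dot4 (nab4 i S) T + dot4 S (nab4 i T).
Proof.
have := congr2 +%R (congr2 +%R (congr2 +%R (congr2 +%R (der_dot4_aux i S T)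
  (esym (om_skew_slot1 i S T))) (esym (om_skew_slot2 i S T))) (esym (om_skew_slot3 i S T)))
      (esym (om_skew_slot4 i S T)).
rewrite !addr0 => ->; rewrite /cov4 !dot4D !(dot4C _ T) !dot4D; ring.
Qed.

Section Decomposition.
Variables (A : array2) (W : array4).
Hypothesis As : forall i j, A i j = A j i.
Hypothesis W_dec : forall i j k l, W i j k l = Rm i j k l - KN_delta A i j k l.
Hypothesis Wtf : forall i k, \sum_j W i j k j = 0.
Hypothesis Wdiv : forall i j k, \sum_m nab4 m W i j k m = 0.
Hypothesis n4 : (4 <= n)%N.

Lemma W_curvature_like : curvature_like W.
Proof.
have [al ar b] := frame_riem_curvature_like; have [kl kr kb] := KN_delta_curvature_like As.
split=> i j k l; rewrite !W_dec.
- by rewrite al kl; ring.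
- by rewrite ar kr; ring.
- by rewrite -[RHS]subr0 -{1}(b i j k l) -(kb i j k l); ring.
Qed.

Definition cotton m i k := nab2 m A i k - nab2 i A m k.

Lemma cov4_W m i j k l : nab4 m W i j k l = nab4 m Rm i j k l - KN_delta (nab2 m A) i j k l.
Proof. by rewrite (cov4_ext _ W_dec) cov4B cov4_KN_delta. Qed.

Definition cyc_W m i j k l := nab4 m W i j k l + nab4 i W j m k l + nab4 j W m i k l.

(** Subtract the second Bianchi identity of the curvature: only derivatives
    of [A] remain, and those with the same Kronecker symbol pair up. *)
Lemma cyc_WE m i j k l : cyc_W m i j k l =
  - (cotton m i k * kd j l + cotton i j k * kd m l + cotton j m k * kd i l
     - cotton m i l * kd j k - cotton i j l * kd m k - cotton j m l * kd i k).
Proof.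
rewrite /cyc_W !cov4_W -[LHS]subr0 -(frame_riem_bianchi2 derD derM jacobi om_anti der_comm m i j k l) /KN_delta /cotton.
rewrite (kdC i k) (kdC j k) (kdC m k) (kdC i l) (kdC j l) (kdC m l).
ring.
Qed.

Lemma cov2_0 m (T : array2) i j : (forall i j, T i j = 0) -> nab2 m T i j = 0.
Proof.
move=> H; rewrite /cov2 H (der0 derD) !big1 ?addr0 // => p _; by rewrite H mulr0.
Qed.

Lemma cotton_anti m i k : cotton m i k = - cotton i m k.
Proof. by rewrite /cotton opprB. Qed.

(** Contracting [cyc_WE] over j = l kills the left-hand side, because W is
    trace free and divergence free.  A second trace of the result shows that the
    trace of the Cotton tensor vanishes, and then (n - 3) C = 0. *)
Lemma cotton0 m i k : cotton m i k = 0.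
Proof.
pose t i := \sum_j cotton i j j.
(* n - 3 = N + 1 is a positive integer, hence cancellable *)
have [N nE] : exists N, n = N.+4 by exists (n - 4)%N; rewrite -addn4 subnK.
have nR : n%:R = N%:R + 4%:R :> F by rewrite [in LHS]nE -addn4 natrD.
have tr_id a b d : (n%:R - 3) * cotton a b d - t b * kd a d + t a * kd b d = 0.
  have : \sum_j cyc_W a b j d j = 0.
    rewrite /cyc_W 2!big_split /= cov4_trace cov2_0; last exact: Wtf.
    have -> : \sum_j nab4 b W j a d j = - nab2 b (ricci W) a d.
      rewrite -cov4_trace -sumrN; apply: eq_bigr => j _.
      by case: (cov4_curvature_like b W_curvature_like) => ->.
    by rewrite cov2_0 ?Wdiv; [rewrite oppr0 !addr0 | exact: Wtf].
  under eq_bigr do rewrite cyc_WE.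
  rewrite sumrN => /eqP; rewrite oppr_eq0 => /eqP; rewrite 3!sumrB 2!big_split /=.
  rewrite (sum_kd (fun j => cotton a b j) d).
  have -> : \sum_(j < n) cotton a b d * kd j j = n%:R * cotton a b d.
    under eq_bigr do rewrite eqxx mulr1.
    by rewrite sumr_const card_ord mulr_natl.
  rewrite (sum_kdl (fun j => cotton b j d) a) (sum_kdl (fun j => cotton j a d) b).
  rewrite -!mulr_suml (cotton_anti b a).
  have -> : \sum_j cotton j a j = - t a.
    by rewrite -sumrN; apply: eq_bigr => j _; exact: cotton_anti.
  by move=> <-; rewrite /t; ring.
have t0 a : t a = 0.
  have : \sum_b ((n%:R - 3) * cotton a b b - t b * kd a b + t a * kd b b) = 0.
    by rewrite big1 // => b _; exact: tr_id.
  rewrite big_split /= sumrB -mulr_sumr.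
  rewrite sum_kdl.
  under eq_bigr do rewrite eqxx mulr1.
  rewrite sumr_const card_ord -/(t a) -(mulr_natl (t a) n) nR => H.
  (* here 2 n - 4 = 2 N + 4 is the factor of the trace *)
  apply: (torsion_free (k := N.*2.+3)); rewrite -[RHS]H -addnn.
  by rewrite -addn4 !natrD; ring.
apply: (torsion_free (k := N)); rewrite -[RHS](tr_id m i k) !t0 nR.
by rewrite -addn1 natrD; ring.
Qed.

Lemma W_bianchi2 m i j k l : cyc_W m i j k l = 0.
Proof. by rewrite cyc_WE !cotton0; ring. Qed.

(** Second covariant derivative: the direction [i] of the inner derivative is
    itself differentiated as a tensor index. *)
Definition hess4 m i : array4 := fun a b d e =>
  nab4 m (nab4 i W) a b d e + \sum_p om m i p * nab4 p W a b d e.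

Lemma hess4_comm i j a b d e : hess4 i j a b d e - hess4 j i a b d e =
  \sum_p Rm i j a p * W p b d e + \sum_p Rm i j b p * W a p d e
  + \sum_p Rm i j d p * W a b p e + \sum_p Rm i j e p * W a b d p.
Proof.
rewrite -(cov4_comm derD derM der_comm) /hess4.
have -> : \sum_p struct_coef om i j p * nab4 p W a b d e =
  \sum_p om j i p * nab4 p W a b d e - \sum_p om i j p * nab4 p W a b d e.
  rewrite -sumrB; apply: eq_bigr => p _; rewrite /struct_coef (om_anti i p j) (om_anti j p i); ring.
ring.
Qed.

Lemma hess4_anti m i a b d e : hess4 m i a b d e = - hess4 m i b a d e.
Proof.
have al u a' b' d' e' : nab4 u W a' b' d' e' = - nab4 u W b' a' d' e'.
  by case: (cov4_curvature_like u W_curvature_like) => + _ _; exact.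
have [al2 _ _] := cov4_curvature_like m (cov4_curvature_like i W_curvature_like).
have E : \sum_p om m i p * nab4 p W a b d e = - \sum_p om m i p * nab4 p W b a d e.
  by rewrite -sumrN; apply: eq_bigr => p _; rewrite al mulrN.
by rewrite /hess4 al2 E; exact: esym (opprD _ _).
Qed.

(** Covariant derivative of [W_bianchi2]. *)
Lemma hess4_cyclic m i j q k l : hess4 m i j q k l + hess4 m j q i k l + hess4 m q i j k l = 0.
Proof.
have E (x : 'I_n) T1 T2 T3 : (forall p, T1 p + T2 p + T3 p = 0) ->
  \sum_p om m x p * T1 p + \sum_p om m x p * T2 p + \sum_p om m x p * T3 p = 0.
  move=> H; rewrite -!big_split big1 //= => p _.
  by rewrite -!mulrDr H mulr0.
have D0 : D m (nab4 i W j q k l) + D m (nab4 j W q i k l) + D m (nab4 q W i j k l) = 0.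
  by rewrite -!derD [X in D m X]W_bianchi2 (der0 derD).
have E1 := E i _ _ _ (fun p => W_bianchi2 p j q k l).
have E2 := E j _ _ _ (fun p => W_bianchi2 i p q k l).
have E3 := E q _ _ _ (fun p => W_bianchi2 i j p k l).
have E4 := E k _ _ _ (fun p => W_bianchi2 i j q p l).
have E5 := E l _ _ _ (fun p => W_bianchi2 i j q k p).
rewrite /hess4 (cov4E m (nab4 i W)) (cov4E m (nab4 j W)) (cov4E m (nab4 q W)).
have := congr2 +%R (congr2 +%R (congr2 +%R (congr2 +%R (congr2 +%R D0 E1) E2) E3) E4) E5.
by rewrite !addr0 => E0; rewrite -[RHS]E0; ring.
Qed.

Lemma W_div1 j k l : \sum_m nab4 m W m j k l = 0.
Proof.
rewrite -[RHS](Wdiv l k j); apply: eq_bigr => m _.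
have [al ar _] := cov4_curvature_like m W_curvature_like.
by rewrite (pair_sym torsion_free (cov4_curvature_like m W_curvature_like)) al ar opprK.
Qed.

(** Covariant derivative of [W_div1]. *)
Lemma hess4_div i j k l : \sum_m hess4 i m m j k l = 0.
Proof.
pose X m := nab4 m W.
have V (x : 'I_n) (T : array2) : (forall p, \sum_m T m p = 0) -> \sum_m \sum_p om i x p * T m p = 0.
  move=> H; rewrite exchange_big big1 // => p _ /=.
  by rewrite -mulr_sumr H mulr0.
rewrite /hess4 big_split /=.
rewrite {1}/cov4 4!big_split /= -(der_sum derD) W_div1 (der0 derD).
rewrite (V j (fun m p => X m m p k l)); last by move=> p; exact: W_div1.
rewrite (V k (fun m p => X m m j p l)); last by move=> p; exact: W_div1.
rewrite (V l (fun m p => X m m j k p)); last by move=> p; exact: W_div1.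
have -> : \sum_m \sum_p om i m p * X m p j k l = - \sum_m \sum_p om i m p * X p m j k l.
  rewrite -sumrN exchange_big; apply: eq_bigr => p _ /=; rewrite -sumrN.
  by apply: eq_bigr => m _; rewrite om_anti mulNr.
by rewrite /X; ring.
Qed.

(** Contract [hess4_cyclic] with m = q.  The other two terms differentiate W
    first in the direction of a free index and then in the contracted one;
    exchanging the derivatives costs a commutator and leaves a divergence. *)
Lemma hess4_trace i j k l : \sum_m hess4 m m i j k l =
  ricci_terms Rm W i j k l - ricci_terms Rm W j i k l.
Proof.
have X a b : ricci_terms Rm W a b k l = \sum_m hess4 m a m b k l.
  transitivity (\sum_m hess4 m a m b k l - \sum_m hess4 a m m b k l).
    by rewrite -sumrB; apply: eq_bigr => m _; rewrite hess4_comm.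
  by rewrite hess4_div subr0.
rewrite !X -sumrB; apply: eq_bigr => m _.
have := hess4_cyclic m i j m k l; rewrite (hess4_anti m i j m) => H.
by rewrite -[LHS]subr0 -[X in _ - X]H; ring.
Qed.

Lemma laplacian_dot4 : \sum_i (D i (D i (dot4 W W)) + \sum_p om i i p * D p (dot4 W W)) =
  2 * \sum_i dot4 (nab4 i W) (nab4 i W)
  + 2 * dot4 W (fun a b d e => \sum_m hess4 m m a b d e).
Proof.
have D1 i : D i (dot4 W W) = 2 * dot4 W (nab4 i W).
  by rewrite der_dot4 (dot4C _ W) mulr_natl mulr2n.
have -> : dot4 W (fun a b d e => \sum_m hess4 m m a b d e) = \sum_m dot4 W (hess4 m m).
  transitivity (\sum_m 1 * dot4 W (hess4 m m)); last by apply: eq_bigr => m _; rewrite mul1r.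
  rewrite -dot4_sumr; apply: dot4_eq => a b d e; congr (_ * _).
  by apply: eq_bigr => m _; rewrite mul1r.
rewrite -mulrDr -big_split mulr_sumr; apply: eq_bigr => i _ /=.
rewrite D1 derM (der_nat derD derM) mul0r add0r der_dot4.
under eq_bigr do rewrite D1 mulrCA.
by rewrite -mulr_sumr -mulrDr /hess4 dot4D -addrA dot4_sumr.
Qed.

(** The Bochner formula for 4 |W|^2, which is [dot4 W W]. *)
Lemma bochner : \sum_i (D i (D i (dot4 W W)) + \sum_p om i i p * D p (dot4 W W)) =
  2 * \sum_i dot4 (nab4 i W) (nab4 i W) + 4 * dot2 (ricci Rm) (gram_left W)
   - 2 * dot4 W (sq2 W) - 4 * dot4 W (sharp W).
Proof.
have Wcl := W_curvature_like.
have R_dec i j k l : Rm i j k l = W i j k l + KN_delta A i j k l by rewrite W_dec subrK.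
have -> : 2 * \sum_i dot4 (nab4 i W) (nab4 i W) + 4 * dot2 (ricci Rm) (gram_left W)
   - 2 * dot4 W (sq2 W) - 4 * dot4 W (sharp W) =
   2 * \sum_i dot4 (nab4 i W) (nab4 i W) + 2 * (2 * dot4 W (ricci_terms Rm W)).
  rewrite (dot4_ricci_terms torsion_free Wcl Wtf As R_dec); ring.
rewrite laplacian_dot4; congr (_ + 2 * _).
have -> : dot4 W (fun a b d e => \sum_m hess4 m m a b d e) =
  dot4 W (fun a b d e => ricci_terms Rm W a b d e) + dot4 W (fun a b d e =>
      - ricci_terms Rm W b a d e).
  by rewrite -dot4D; apply: dot4_eq => a b d e; rewrite hess4_trace.
rewrite mulr_natl mulr2n; congr (_ + _); rewrite [RHS]dot4_swap12.
apply: dot4_eq => a b d e; case: Wcl => al _ _; by rewrite (al b a) mulrN mulNr.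
Qed.

End Decomposition.
End Bochner.

(** * The Levi-Civita connection in an orthonormal frame *)

Section Coordinates.
Variables (F : comPzRingType) (n : nat).
Variable dx : 'I_n -> F -> F.
Hypothesis dxD : forall i f g, dx i (f + g) = dx i f + dx i g.
Hypothesis dxM : forall i f g, dx i (f * g) = dx i f * g + f * dx i g.
Hypothesis dxC : forall i j f, dx i (dx j f) = dx j (dx i f).
Variables (half : F) (G E : 'I_n -> 'I_n -> F).
Hypothesis halfK : 2 * half = 1.
Hypothesis G_sym : forall a b, G a b = G b a.
Hypothesis E_orth : forall i j, \sum_a \sum_b E i a * G a b * E j b = (i == j)%:R.
(** Inverse Gram matrix, expressed through an orthonormal frame [E]. *)
Definition cometric a b := \sum_i E i a * E i b.
Hypothesis cometricK : forall a c, \sum_b G a b * cometric b c = (a == c)%:R.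

Definition frame_der i f := \sum_a E i a * dx a f.
Local Notation D := frame_der.

Lemma frame_derD i f g : D i (f + g) = D i f + D i g.
Proof. by rewrite -big_split; apply: eq_bigr => a _; rewrite dxD mulrDr. Qed.

Lemma frame_derM i f g : D i (f * g) = D i f * g + f * D i g.
Proof.
rewrite /D mulr_suml mulr_sumr -big_split; apply: eq_bigr => a _ /=.
rewrite dxM; ring.
Qed.

(** Christoffel symbols of the coordinate metric [G]. *)
Definition coord_chr a b c := half * \sum_l cometric a l * (dx b (G c l) + dx c (G b l) - dx l
    (G b c)).

(** Coordinate components of nabla_{e_i} e_j. *)
Definition nabla_frame i j a := D i (E j a) + \sum_b \sum_c coord_chr a b c * E i b * E j c.

Definition frame_om i k j := \sum_a \sum_b nabla_frame i j a * G a b * E k b.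
Local Notation om := frame_om.

Lemma nabla_frameE i j c : nabla_frame i j c = \sum_k om i k j * E k c.
Proof.
transitivity (\sum_a nabla_frame i j a * (\sum_b G a b * cometric b c)).
  by under eq_bigr do rewrite cometricK; rewrite sum_kd.
under [RHS]eq_bigr do (rewrite mulr_suml; under eq_bigr do rewrite mulr_suml).
rewrite [RHS]exchange_big; apply: eq_bigr => a _ /=; rewrite [RHS]exchange_big mulr_sumr.
apply: eq_bigr => b _ /=; rewrite !mulr_sumr; apply: eq_bigr => k _; ring.
Qed.

Lemma coord_chr_sym a b c : coord_chr a b c = coord_chr a c b.
Proof.
by congr (_ * _); apply: eq_bigr => l _; rewrite (G_sym c b); congr (_ * _); ring.
Qed.

Lemma coord_chr_lower b c d : \sum_a coord_chr a b c * G a d =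
  half * (dx b (G c d) + dx c (G b d) - dx d (G b c)).
Proof.
pose K l := dx b (G c l) + dx c (G b l) - dx l (G b c).
transitivity (half * \sum_l K l * (\sum_a G d a * cometric a l)).
  rewrite mulr_sumr; under eq_bigr do rewrite /coord_chr -mulrA mulr_suml mulr_sumr.
  rewrite exchange_big; apply: eq_bigr => l _ /=; rewrite !mulr_sumr; apply: eq_bigr => a _.
  by rewrite (G_sym a d) /K; ring.
by under eq_bigr do rewrite cometricK; rewrite sum_kdl.
Qed.

(** Metric compatibility of the Christoffel symbols. *)
Lemma coord_chr_lower_sum b c d : \sum_a coord_chr a b c * G a d
    + \sum_a coord_chr a b d * G a c = dx b (G c d).
Proof.
rewrite !coord_chr_lower (G_sym d c); transitivity (2 * half * dx b (G c d)); first by ring.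
by rewrite halfK mul1r.
Qed.

Lemma frame_omE i k j : om i k j = \sum_a \sum_d D i (E j a) * G a d * E k d
   + \sum_b \sum_c \sum_d (\sum_a coord_chr a b c * G a d) * E i b * E j c * E k d.
Proof.
rewrite /om /nabla_frame.
under eq_bigr do under eq_bigr do rewrite -mulrA mulrDl.
under eq_bigr do rewrite big_split; rewrite big_split /=.
congr (_ + _); first by do 2! (apply: eq_bigr => ? _); rewrite mulrA.
under eq_bigr do under eq_bigr do rewrite mulr_suml.
under eq_bigr do rewrite exchange_big /=; rewrite exchange_big; apply: eq_bigr => b _ /=.
under eq_bigr do under eq_bigr do rewrite mulr_suml.
under eq_bigr do rewrite exchange_big /=; rewrite exchange_big; apply: eq_bigr => c _ /=.
rewrite exchange_big; apply: eq_bigr => d _ /=.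
by rewrite !mulr_suml; apply: eq_bigr => a _; ring.
Qed.

(** Differentiate the orthonormality relation along e_i; the derivative of [G]
    is a sum of Christoffel symbols by [coord_chr_lower_sum]. *)
Lemma frame_om_anti i k j : om i k j = - om i j k.
Proof.
pose P u v := \sum_a \sum_d D i (E u a) * G a d * E v d.
pose Q u v := \sum_b \sum_c \sum_d (\sum_a coord_chr a b c * G a d) * E i b * E u c * E v d.
pose M := \sum_a \sum_d E j a * D i (G a d) * E k d.
have DE : P j k + M + P k j = 0.
  rewrite -[RHS](der_nat frame_derD frame_derM i (j == k)) -E_orth.
  have -> : P k j = \sum_a \sum_d E j a * G a d * D i (E k d).
    by rewrite /P exchange_big; do 2! (apply: eq_bigr => ? _); rewrite G_sym; ring.
  rewrite (der_sum frame_derD) -!big_split; apply: eq_bigr => a _ /=.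
  rewrite (der_sum frame_derD) -!big_split; apply: eq_bigr => d _ /=.
  by rewrite !frame_derM; ring.
have QM : Q j k + Q k j = M.
  have -> : Q k j = \sum_b \sum_c \sum_d (\sum_a coord_chr a b d * G a c) * E i b * E k d * E j c.
    by apply: eq_bigr => b _; rewrite exchange_big.
  rewrite -big_split /=.
  transitivity (\sum_b \sum_c \sum_d E j c * (E i b * dx b (G c d)) * E k d).
    apply: eq_bigr => b _; rewrite -big_split; apply: eq_bigr => c _ /=.
    rewrite -big_split; apply: eq_bigr => d _ /=.
    by rewrite -coord_chr_lower_sum; ring.
  rewrite exchange_big; apply: eq_bigr => c _ /=.
  rewrite exchange_big; apply: eq_bigr => d _ /=.
  by rewrite /frame_der mulr_sumr mulr_suml.
apply/eqP; rewrite -addr_eq0; apply/eqP.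
rewrite !frame_omE -/(P j k) -/(P k j) -/(Q j k) -/(Q k j).
by rewrite -[RHS]DE -QM; ring.
Qed.

(** The connection has no torsion: the Christoffel symbols are symmetric and
    cancel in nabla_{e_i} e_j - nabla_{e_j} e_i. *)
Lemma frame_torsion i j c : \sum_k struct_coef om i j k * E k c = D i (E j c) - D j (E i c).
Proof.
transitivity (nabla_frame i j c - nabla_frame j i c).
  by rewrite !nabla_frameE -sumrB; apply: eq_bigr => k _; rewrite /struct_coef; ring.
rewrite /nabla_frame [X in _ - (_ + X)]exchange_big /=.
have -> : \sum_a \sum_b coord_chr c b a * E j b * E i a =
    \sum_b \sum_a coord_chr c b a * E i b * E j a.
  by do 2! (apply: eq_bigr => ? _); rewrite coord_chr_sym; ring.
ring.
Qed.

Lemma frame_der_comm i j f : D i (D j f) - D j (D i f) = \sum_p struct_coef om i j p * D p f.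
Proof.
have DD k l : D k (D l f) = \sum_b D k (E l b) * dx b f + \sum_a \sum_b E k a * E l b * dx a
    (dx b f).
  rewrite {1}/D; under eq_bigr do rewrite (der_sum dxD) mulr_sumr.
  under [X in _ = X + _]eq_bigr do rewrite mulr_suml.
  rewrite [X in _ = X + _]exchange_big -big_split; apply: eq_bigr => a _ /=.
  by rewrite -big_split; apply: eq_bigr => b _ /=; rewrite dxM; ring.
rewrite !DD.
have -> : \sum_a \sum_b E j a * E i b * dx a (dx b f) = \sum_a \sum_b E i a * E j b * dx a (dx b f).
  by rewrite exchange_big; do 2! (apply: eq_bigr => ? _); rewrite dxC; ring.
transitivity (\sum_b (\sum_p struct_coef om i j p * E p b) * dx b f).
  by under [RHS]eq_bigr do rewrite frame_torsion mulrBl; rewrite sumrB; ring.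
under eq_bigr do rewrite mulr_suml.
rewrite exchange_big; apply: eq_bigr => p _ /=.
by rewrite mulr_sumr; apply: eq_bigr => b _; rewrite mulrA.
Qed.

Lemma frame_faithful (v : 'I_n -> F) : (forall c, \sum_q v q * E q c = 0) -> forall q, v q = 0.
Proof.
move=> H q; rewrite -(sum_kd v q).
under eq_bigr => p _ do rewrite -E_orth mulr_sumr.
rewrite exchange_big big1 //= => a _; under eq_bigr do rewrite mulr_sumr.
rewrite exchange_big big1 //= => b _.
transitivity ((\sum_p v p * E p a) * (G a b * E q b)); last by rewrite H mul0r.
by rewrite mulr_suml; apply: eq_bigr => p _; ring.
Qed.

(** A frame is linearly independent, so it suffices to expand the Jacobi
    identity of the vector fields e_m, e_i, e_j in coordinates, where by
    [frame_torsion] it becomes an alternating sum of second derivatives of the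
    components of the frame. *)
Lemma frame_jacobi m i j q : jacobiator D om m i j q + jacobiator D om i j m q
    + jacobiator D om j m i q = 0.
Proof.
move: q; apply: frame_faithful => c.
have J k l p : \sum_q jacobiator D om k l p q * E q c =
   D k (D l (E p c)) - D k (D p (E l c)) - (D l (D p (E k c)) - D p (D l (E k c))).
  rewrite -(derB frame_derD) -frame_torsion (der_sum frame_derD) frame_der_comm.
  rewrite /jacobiator; under eq_bigr do rewrite mulrDl mulr_suml; rewrite big_split /=.
  rewrite [X in _ + X]exchange_big /=.
  have -> : \sum_a \sum_b struct_coef om l p a * struct_coef om k a b * E b c =
    \sum_a struct_coef om l p a * (D k (E a c) - D a (E k c)).
    apply: eq_bigr => a _; rewrite -frame_torsion mulr_sumr.
    by apply: eq_bigr => b _; rewrite mulrA.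
  rewrite -big_split -sumrB; apply: eq_bigr => a _ /=; rewrite frame_derM; ring.
under eq_bigr do rewrite 2!mulrDl.
rewrite 2!big_split /= !J; ring.
Qed.

End Coordinates.

(** * Components of covariant derivatives of vector fields *)

Section VectorFields.
Variables (F : comPzRingType) (n : nat).
Variable D : 'I_n -> F -> F.
Hypothesis derD : forall i f g, D i (f + g) = D i f + D i g.
Hypothesis derM : forall i f g, D i (f * g) = D i f * g + f * D i g.
Variable om : 'I_n -> 'I_n -> 'I_n -> F.
Hypothesis der_comm : forall i j f,
  D i (D j f) - D j (D i f) = \sum_p struct_coef om i j p * D p f.
Local Notation c := (struct_coef om).

Lemma cov1_comm i j t q :
  cov1 D om i (cov1 D om j t) q - cov1 D om j (cov1 D om i t) q =
  \sum_p c i j p * cov1 D om p t q + \sum_l frame_riem D om i j q l * t l.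
Proof.
pose L := lift_connection om (scalar_connection derD derM).
pose U (S : 'I_n -> F) := fun u : 'I_n * unit => S u.1.
have LE k S : L k (U S) = U (cov1 D om k S) by apply: funext => -[x []].
have := @curv_lift _ _ _ derD om _ (scalar_connection derD derM) i j (U t) q tt.
rewrite (curv_scalar derD derM der_comm) add0r /curv -/L !LE.
under eq_bigr do rewrite LE; rewrite /U /= => <-; ring.
Qed.

Lemma cov1_leibniz i (b : 'I_n -> F) (S : 'I_n -> 'I_n -> F) q :
  cov1 D om i (fun q => \sum_j b j * S j q) q =
  \sum_j D i (b j) * S j q + \sum_j b j * cov1 D om i (S j) q.
Proof.
rewrite {1}/cov1 (der_sum derD); under eq_bigr do rewrite derM.
under [X in _ + X = _]eq_bigr do rewrite mulr_sumr.
rewrite exchange_big big_split /= -addrA; congr (_ + _).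
rewrite -big_split; apply: eq_bigr => j _ /=; rewrite /cov1 mulrDr mulr_sumr; congr (_ + _).
by apply: eq_bigr => p _; rewrite mulrCA.
Qed.

Definition nabla_coef (a b : 'I_n -> F) q := \sum_i a i * cov1 D om i b q.

(** Curvature is tensorial: derivatives of the coefficients cancel, and the
    bracket of the two fields absorbs the first derivatives of the third. *)
Lemma nabla_coef_curv a b t q :
  nabla_coef a (nabla_coef b t) q - nabla_coef b (nabla_coef a t) q - nabla_coef (fun p =>
      nabla_coef a b p - nabla_coef b a p) t q =
  \sum_i \sum_j \sum_l frame_riem D om i j q l * a i * b j * t l.
Proof.
pose C j := cov1 D om j t q.
have N u v : nabla_coef u (nabla_coef v t) q = \sum_i \sum_j u i * D i (v j) * C j
     + \sum_i \sum_j u i * v j * cov1 D om i (cov1 D om j t) q.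
  rewrite -big_split; apply: eq_bigr => i _ /=; rewrite cov1_leibniz mulrDr !mulr_sumr.
  by congr (_ + _); apply: eq_bigr => j _; rewrite mulrA.
have B : nabla_coef (fun p => nabla_coef a b p - nabla_coef b a p) t q =
   \sum_i \sum_j a i * D i (b j) * C j - \sum_i \sum_j b i * D i (a j) * C j
   + \sum_i \sum_j \sum_p a i * b j * (c i j p * C p).
  transitivity (\sum_j (nabla_coef a b j * C j) - \sum_j nabla_coef b a j * C j).
    by rewrite -sumrB; apply: eq_bigr => j _; rewrite mulrBl.
  have M (K : 'I_n -> F) u v : \sum_j nabla_coef u v j * K j = \sum_i \sum_j u i * D i (v j) * K j
      + \sum_i \sum_j \sum_p u i * v j * (om i p j * K p).
    rewrite /nabla_coef; under eq_bigr do rewrite mulr_suml.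
    rewrite exchange_big -big_split; apply: eq_bigr => i _ /=.
    rewrite [X in _ = _ + X]exchange_big -big_split; apply: eq_bigr => j _ /=.
    rewrite /cov1 mulrDr mulrDl mulr_sumr mulr_suml; congr (_ + _).
    by apply: eq_bigr => p _; ring.
  rewrite !M.
  have -> : \sum_i \sum_j \sum_p b i * a j * (om i p j * C p) =
      \sum_i \sum_j \sum_p a i * b j * (om j p i * C p).
    by rewrite exchange_big; do 3! (apply: eq_bigr => ? _); ring.
  have -> : \sum_i \sum_j \sum_p a i * b j * (c i j p * C p) =
    \sum_i \sum_j \sum_p a i * b j * (om i p j * C p) - \sum_i \sum_j \sum_p a i * b j *
        (om j p i * C p).
    rewrite -sumrB; apply: eq_bigr => i _; rewrite -sumrB; apply: eq_bigr => j _.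
    by rewrite -sumrB; apply: eq_bigr => p _; rewrite /struct_coef; ring.
  ring.
rewrite B !N.
have -> : \sum_i \sum_j b i * a j * cov1 D om i (cov1 D om j t) q =
  \sum_i \sum_j a i * b j * cov1 D om j (cov1 D om i t) q.
  by rewrite exchange_big; do 2! (apply: eq_bigr => ? _); ring.
transitivity (\sum_i \sum_j a i * b j * (cov1 D om i (cov1 D om j t) q - cov1 D om j
    (cov1 D om i t) q)
  - \sum_i \sum_j \sum_p a i * b j * (c i j p * C p)).
  have -> : \sum_i \sum_j a i * b j * (cov1 D om i (cov1 D om j t) q - cov1 D om j
      (cov1 D om i t) q)
    = \sum_i \sum_j a i * b j * cov1 D om i (cov1 D om j t) q
     - \sum_i \sum_j a i * b j * cov1 D om j (cov1 D om i t) q.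
    by rewrite -sumrB; apply: eq_bigr => i _; rewrite -sumrB; apply: eq_bigr => j _; rewrite mulrBr.
  ring.
rewrite -sumrB; apply: eq_bigr => i _; rewrite -sumrB; apply: eq_bigr => j _.
rewrite cov1_comm mulrDr -mulr_sumr [LHS]addrAC subrr add0r mulr_sumr.
by apply: eq_bigr => l _; ring.
Qed.
End VectorFields.

Section FrameVectors.
Variables (F : comPzRingType) (n : nat).
Variable dx : 'I_n -> F -> F.
Hypothesis dxD : forall i f g, dx i (f + g) = dx i f + dx i g.
Hypothesis dxM : forall i f g, dx i (f * g) = dx i f * g + f * dx i g.
Variables (half : F) (G E : 'I_n -> 'I_n -> F).
Hypothesis E_orth : forall i j, \sum_a \sum_b E i a * G a b * E j b = (i == j)%:R.
Hypothesis cometricK : forall a c, \sum_b G a b * cometric E b c = (a == c)%:R.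
Local Notation D := (frame_der dx E).
Local Notation om := (frame_om dx half G E).

Definition vec_of (a : 'I_n -> F) al := \sum_i a i * E i al.

(** The coordinate formula for nabla_X Y agrees with the frame formula. *)
Lemma vec_nabla a b al :
  \sum_k vec_of a k * dx k (vec_of b al)
   + \sum_k \sum_l coord_chr dx half G E al k l * vec_of a k * vec_of b l =
       vec_of (nabla_coef D om a b) al.
Proof.
have DE f : \sum_k vec_of a k * dx k f = \sum_i a i * D i f.
  rewrite /vec_of; under eq_bigr do rewrite mulr_suml.
  rewrite exchange_big; apply: eq_bigr => i _ /=; rewrite mulr_sumr.
  by apply: eq_bigr => k _; rewrite mulrA.
have CE : \sum_k \sum_l coord_chr dx half G E al k l * vec_of a k * vec_of b l =
  \sum_i a i * \sum_j b j * (\sum_k \sum_l coord_chr dx half G E al k l * E i k * E j l).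
  rewrite /vec_of.
  under eq_bigr do under eq_bigr do rewrite mulrAC mulr_sumr.
  under eq_bigr do rewrite exchange_big /=; rewrite exchange_big; apply: eq_bigr => i _ /=.
  under eq_bigr do under eq_bigr do rewrite mulr_sumr mulr_suml.
  under eq_bigr do rewrite exchange_big /=; rewrite exchange_big mulr_sumr; apply: eq_bigr =>
      j _ /=.
  rewrite !mulr_sumr; apply: eq_bigr => k _; rewrite !mulr_sumr; apply: eq_bigr => l _; ring.
rewrite DE CE -big_split /vec_of /nabla_coef; under [RHS]eq_bigr do rewrite mulr_suml.
rewrite [RHS]exchange_big; apply: eq_bigr => i _ /=.
rewrite -mulrDr (der_sum (frame_derD dxD E)); under [RHS]eq_bigr do rewrite -mulrA.
rewrite -mulr_sumr; congr (_ * _); rewrite -big_split /=.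
transitivity (\sum_j (D i (b j) * E j al + b j * nabla_frame dx half G E i j al)).
  by apply: eq_bigr => j _; rewrite (frame_derM dxM E) /nabla_frame; ring.
under [RHS]eq_bigr do rewrite /cov1 mulrDl mulr_suml.
rewrite !big_split /=; congr (_ + _).
under eq_bigr do rewrite (nabla_frameE dx half cometricK) mulr_sumr.
by rewrite exchange_big; do 2! (apply: eq_bigr => ? _); ring.
Qed.

Lemma vec_inner a b : \sum_k \sum_l vec_of a k * G k l * vec_of b l = \sum_i a i * b i.
Proof.
transitivity (\sum_i \sum_j a i * b j * (i == j)%:R).
  transitivity (\sum_i \sum_j \sum_k \sum_l a i * b j * (E i k * G k l * E j l)).
    transitivity (\sum_k \sum_l \sum_i \sum_j a i * b j * (E i k * G k l * E j l)).
      apply: eq_bigr => k _; apply: eq_bigr => l _; rewrite /vec_of !mulr_suml.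
      apply: eq_bigr => i _; rewrite mulr_sumr; apply: eq_bigr => j _; ring.
    under eq_bigr do rewrite exchange_big /=; rewrite exchange_big; apply: eq_bigr => i _ /=.
    by under eq_bigr do rewrite exchange_big /=; rewrite exchange_big.
  apply: eq_bigr => i _; apply: eq_bigr => j _; rewrite -E_orth mulr_sumr.
  by apply: eq_bigr => k _; rewrite mulr_sumr.
by apply: eq_bigr => i _; rewrite (sum_kdl (fun j => a i * b j)).
Qed.
End FrameVectors.

(** * Calculus of functions of class C^k *)

Section CkCalculus.
Variables (R : realType) (V : normedModType R).
Implicit Types (U : set V).

(** The differential of f serves as the linear approximation of g, which has the
    same germ. *)
Lemma near_eq_differentiable (W : normedModType R) (f g : V -> W) x :
  {near x, f =1 g} -> differentiable f x -> differentiable g x.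
Proof.
move=> fg df.
have dfc : continuous ('d f x) by apply: diff_continuous.
have E : g \o shift x = cst (g x) + 'd f x +o_ 0 id.
  apply/eqaddoP => _/posnumP[e].
  have /eqaddoP/(_ e%:num)/(_ [gt0 of e%:num]) := diff_locally df.
  have fgx : f x = g x := nbhs_singleton fg.
  have fg0 : \forall h \near (0:V), f (h + x) = g (h + x).
    have : {for (0:V), continuous (fun h : V => h + x)} by apply: cvgD; [exact: cvg_id | exact:
        cvg_cst].
    move=> /(_ [set y | f y = g y]); rewrite add0r; exact.
  rewrite -nbhs_nearE; apply: filter_app; near=> h.
  rewrite /=.
  by rewrite -[(f \o _ - _) h]/(f (h + x) - (f x + 'd f x h))
     -[(g \o _ - _) h]/(g (h + x) - (g x + 'd f x h)) fgx; have -> : f (h + x) =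
         g (h + x) by near: h.
apply/diff_locallyP; have U := diff_unique dfc E.
by rewrite U; split.
Unshelve. all: by end_near. Qed.

Lemma Ck_ext (W : normedModType R) k U (f g : V -> W) : open U ->
  (forall x, U x -> f x = g x) -> Ck k U f -> Ck k U g.
Proof.
move=> oU; have fgn (f' g' : V -> W) (fg : forall x, U x -> f' x = g' x) x :
    U x -> {near x, f' =1 g'}.
  by move=> Ux; near=> y; apply: fg; near: y; exact: open_nbhs_nbhs.
elim: k f g => [|k IH] f g fg /=.
  move=> cf x Ux; change (g @ x --> g x); rewrite -(fg _ Ux).
  apply: cvg_trans (cf x Ux); apply: near_eq_cvg; exact: fgn.
move=> [df cf]; split=> [x Ux|v].
  exact: near_eq_differentiable (fgn _ _ fg _ Ux) (df x Ux).
apply: IH (cf v) => x Ux; exact: near_eq_derive (fgn _ _ fg _ Ux).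
Unshelve. all: by end_near. Qed.

Lemma Ck_pred (W : normedModType R) k U (f : V -> W) : Ck k.+1 U f -> Ck k U f.
Proof.
elim: k f => [|k IH] f; first by case=> df _ x Ux; exact/differentiable_continuous/df.
by case=> df cf; split=> // v; exact: IH (cf v).
Qed.

Lemma Ck_cst (W : normedModType R) k U (a : W) : Ck k U (cst a).
Proof.
elim: k a => [|k IH] a; first by move=> x _; exact: cst_continuous.
split=> [x _|v]; first exact: differentiable_cst.
rewrite (_ : (fun x => _) = cst 0); first exact: IH.
by apply/funext => x; exact: derive_cst.
Qed.

Lemma CkD k U (f g : V -> R) : open U -> Ck k U f -> Ck k U g -> Ck k U (f \+ g).
Proof.
move=> oU; elim: k f g => [|k IH] f g.
  by move=> cf cg x Ux; apply: cvgD; [exact: cf | exact: cg].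
move=> [df cf] [dg cg]; split=> [x Ux|v].
  by apply: differentiableD; [exact: df | exact: dg].
apply: (Ck_ext oU _ (IH _ _ (cf v) (cg v))) => x Ux /=.
by rewrite -deriveD //; apply: diff_derivable; [exact: df | exact: dg].
Qed.

Lemma CkN k U (f : V -> R) : open U -> Ck k U f -> Ck k U (\- f).
Proof.
move=> oU; elim: k f => [|k IH] f.
  by move=> cf x Ux; apply: cvgN; exact: cf.
move=> [df cf]; split=> [x Ux|v].
  by apply: differentiableN; exact: df.
apply: (Ck_ext oU _ (IH _ (cf v))) => x Ux /=.
by rewrite -deriveN //; apply: diff_derivable; exact: df.
Qed.

Lemma CkM k U (f g : V -> R) : open U -> Ck k U f -> Ck k U g -> Ck k U (f \* g).
Proof.
move=> oU; elim: k f g => [|k IH] f g.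
  by move=> cf cg x Ux; apply: cvgM; [exact: cf | exact: cg].
move=> Cf Cg; have Cf' := Ck_pred Cf; have Cg' := Ck_pred Cg.
case: Cf Cg => [df cf] [dg cg]; split=> [x Ux|v].
  by apply: differentiableM; [exact: df | exact: dg].
apply: (Ck_ext oU _ (CkD oU (IH _ _ Cf' (cg v)) (IH _ _ Cg' (cf v)))) => x Ux /=.
by rewrite deriveM //; apply: diff_derivable; [exact: df | exact: dg].
Qed.

Lemma derive_coord m n (f : V -> 'M[R]_(m, n)) x v i j : differentiable f x ->
  ('D_v f x) i j = 'D_v (fun y => f y i j) x.
Proof. by move=> df; rewrite derive_mx ?mxE //; exact: diff_derivable. Qed.

Lemma Ck_coord m n k U (f : V -> 'M[R]_(m, n)) i j : open U -> Ck k U f ->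
  Ck k U (fun x => f x i j : R).
Proof.
move=> oU; elim: k f => [|k IH] f /=.
  move=> cf x Ux; apply: (@continuous_comp _ _ _ f (fun N : 'M[R]_(m, n) => N i j : R) x (cf x Ux)).
  exact: coord_continuous.
move=> [df cf]; split=> [x Ux|v].
  apply: (@differentiable_comp _ _ _ _ f (fun N : 'M[R]_(m, n) => N i j : R)); first exact: df.
  exact: differentiable_coord.
apply: (Ck_ext oU _ (IH _ (cf v))) => x Ux; rewrite derive_coord //; exact: df.
Qed.

End CkCalculus.

(** * Symmetry of second derivatives *)

Section Schwarz.
Variables (R : realType) (V : normedModType R).

Lemma is_derive_line (f : V -> R) (y w : V) (s : R) : differentiable f (y + s *: w) ->
  is_derive s 1 (fun t : R => f (y + t *: w)) ('D_w f (y + s *: w)).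
Proof.
move=> df; have D : derivable f (y + s *: w) w by exact: diff_derivable.
have E : (fun h : R => h^-1 *: ((f \o shift (y + s *: w)) (h *: w) - f (y + s *: w))) =
  (fun h : R => h^-1 *: (((fun t : R => f (y + t *: w)) \o shift s) (h *: 1) - f (y + s *: w))).
  rewrite funeqE => h /=; congr (_ *: (f _ - _)).
  by rewrite [_%:A]mulr1 scalerDl addrCA.
by apply: DeriveDef; [move: D; rewrite /derivable E | rewrite /derive E].
Qed.

Lemma derive_translate (f : V -> R) (y v c : V) :
  'D_v (fun y => f (y + c)) y = 'D_v f (y + c).
Proof.
rewrite /derive; set g1 := fun h => _; set g2 := fun h => _.
suff -> : g1 = g2 by [].
by rewrite funeqE => h; rewrite /g1 /g2 /= addrA.
Qed.

Lemma line_MVT (f : V -> R) (y w : V) (h : R) : 0 < h ->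
  (forall s, 0 <= s <= h -> differentiable f (y + s *: w)) ->
  exists2 s, 0 <= s <= h & f (y + h *: w) - f y = h * 'D_w f (y + s *: w).
Proof.
move=> h0 df; pose g (s : R) := f (y + s *: w).
have gd (s : R) : 0 <= s <= h -> is_derive s 1 g ('D_w f (y + s *: w)).
  by move=> sh; apply: is_derive_line; exact: df.
have [||s sh E] := @MVT_segment R g (fun s => 'D_w f (y + s *: w)) 0 h (ltW h0).
- by move=> s; rewrite in_itv /= => /andP[s0 sh]; apply: gd; rewrite !ltW.
- apply: derivable_within_continuous => s; rewrite in_itv /= => sh.
  by have [] := gd s sh.
exists s; first by move: sh; rewrite in_itv.
by move: E; rewrite /g scale0r addr0 subr0 mulrC.
Qed.

Definition second_difference (f : V -> R) x (p q : V) :=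
  f (x + p + q) - f (x + p) - f (x + q) + f x.

Lemma second_differenceC f x p q : second_difference f x p q = second_difference f x q p.
Proof. by rewrite /second_difference [x + p + _]addrAC; ring. Qed.

Lemma dist_half (a b c e : R) : `|a - c| < e / 2 -> `|b - c| < e / 2 -> `|a - b| <= e.
Proof.
move=> ac bc; rewrite (_ : a - b = (a - c) - (b - c)); last by ring.
apply: le_trans (ler_normB _ _) _; rewrite [leRHS](splitr e); apply: lerD; exact: ltW.
Qed.

(** Two applications of the mean value theorem: first along v to the increment
    of f in the direction u, then along u to the derivative of f along v. *)
Lemma second_difference_MVT (U : set V) (f : V -> R) x (u v : V) (h : R) : 0 < h ->
  (forall s t, 0 <= s <= h -> 0 <= t <= h -> U (x + s *: u + t *: v)) ->
  (forall y, U y -> differentiable f y) ->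
  (forall y, U y -> differentiable (fun y => 'D_v f y) y) ->
  exists s t, [/\ 0 <= s <= h, 0 <= t <= h &
    second_difference f x (h *: u) (h *: v) =
     h ^+ 2 * 'D_u (fun y => 'D_v f y) (x + s *: u + t *: v)].
Proof.
move=> h0 UU df ddf.
have hh : 0 <= h <= h by rewrite lexx ltW.
have h00 : 0 <= (0:R) <= h by rewrite lexx ltW.
pose phi y := f (y + h *: u) - f y.
have dshift t : 0 <= t <= h -> differentiable (fun y => f (y + h *: u)) (x + t *: v).
  move=> th; apply: (@differentiable_comp _ _ _ _ (fun y => y + h *: u) f).
    by apply: differentiableD; [exact: ex_diff|exact: differentiable_cst].
  by apply: df; rewrite addrAC; exact: UU.
have dbase t : 0 <= t <= h -> differentiable f (x + t *: v).
  by move=> th; apply: df; rewrite -[x]addr0 -(scale0r u); exact: UU.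
have dphi t : 0 <= t <= h -> differentiable phi (x + t *: v).
  by move=> th; apply: differentiableB; [exact: dshift | exact: dbase].
have [t th E1] := line_MVT h0 dphi.
have dD s : 0 <= s <= h -> differentiable (fun y => 'D_v f y) (x + t *: v + s *: u).
  by move=> sh; apply: ddf; rewrite addrAC; exact: UU.
have [s sh E2] := line_MVT h0 dD.
exists s, t; split; [exact: sh | exact: th |].
have Dphi : 'D_v phi (x + t *: v) = 'D_v f (x + t *: v + h *: u) - 'D_v f (x + t *: v).
  rewrite deriveB ?derive_translate //.
    exact/diff_derivable/dshift.
  exact/diff_derivable/dbase.
rewrite [x + s *: u + _]addrAC expr2 -mulrA -E2 -Dphi -E1 /phi /second_difference.
rewrite [x + h *: v + _]addrAC opprB addrA; ring.
Qed.

Lemma small_square (U : set V) (x u v : V) : nbhs x U ->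
  exists2 h : R, 0 < h &
    forall s t, 0 <= s <= h -> 0 <= t <= h -> U (x + s *: u + t *: v).
Proof.
move=> /nbhs_ballP[r r0 Ur].
have c0 : 0 < `|u| + `|v| + 1 by rewrite ltr_wpDl // addr_ge0.
(* dividing by the sum of the norms plus one also covers u = v = 0 *)
exists (r / 2 / (`|u| + `|v| + 1)); first by rewrite !divr_gt0.
move=> s t /andP[s0 sh] /andP[t0 th]; apply: Ur; rewrite -ball_normE /=.
rewrite -addrA opprD addNKr normrN.
apply: le_lt_trans (ler_normD _ _) _; rewrite !normrZ (ger0_norm s0) (ger0_norm t0).
set h := r / 2 / _ in sh th.
apply: (@le_lt_trans _ _ (h * (`|u| + `|v| + 1))).
  rewrite !mulrDr mulr1 -[leLHS]addr0 lerD //; last by rewrite (le_trans s0).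
  by rewrite lerD // ler_wpM2r.
by rewrite /h divfK ?gt_eqF // gtr_pMr // invf_lt1 // ltr1n.
Qed.

(** Schwarz theorem.  The second difference is symmetric in u and v, and
    [second_difference_MVT] makes it h^2 times either mixed derivative at points
    as close to x as desired; continuity of both derivatives concludes. *)
Lemma derive_comm (U : set V) (f : V -> R) x (u v : V) : open U -> U x -> Ck 2 U f ->
  'D_u (fun y => 'D_v f y) x = 'D_v (fun y => 'D_u f y) x.
Proof.
move=> oU Ux [df cf].
have ddf w y : U y -> differentiable (fun y => 'D_w f y) y by case: (cf w) => + _; exact.
have cc w w' : {for x, continuous (fun y => 'D_w (fun z => 'D_w' f z) y)}.
  by case: (cf w') => _ /(_ w); exact.
apply/eqP; rewrite -subr_eq0 -normr_le0; apply/ler_addgt0Pl => e e0; rewrite addr0.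
have e2 : 0 < e / 2 by rewrite divr_gt0.
pose P u v y := `|'D_u (fun z => 'D_v f z) x - 'D_u (fun z => 'D_v f z) y| < e / 2.
have nP w w' : nbhs x (P w w').
  by have /cvgr_dist_lt/(_ _ e2) := cc w w'.
have nU : nbhs x (U `&` (P u v `&` P v u)).
  by apply: filterI; [exact: open_nbhs_nbhs | apply: filterI].
have [h h0 H] := small_square u v nU.
have [s [t [sh th E1]]] := second_difference_MVT h0 (fun s t sh th => (H s t sh th).1) df (ddf v).
have H' s' t' : 0 <= s' <= h -> 0 <= t' <= h -> U (x + s' *: v + t' *: u).
  by move=> sh' th'; rewrite addrAC; case: (H t' s' th' sh').
have [s' [t' [sh' th' E2]]] := second_difference_MVT h0 H' df (ddf u).
have [_ [P1 _]] := H s t sh th.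
have [_ [_ P2]] := H t' s' th' sh'.
have EE : h ^+ 2 * _ = h ^+ 2 * _ := etrans (esym E1) (etrans (second_differenceC _ _ _ _) E2).
have h2 : h ^+ 2 != 0 := lt0r_neq0 (exprn_gt0 2 h0).
have Ey : x + t' *: u + s' *: v = x + s' *: v + t' *: u by exact: addrAC.
rewrite Ey in P2; apply: (dist_half P1).
by have -> := mulfI h2 EE; exact: P2.
Qed.
End Schwarz.

(** * The ring of smooth functions on an open set *)

Section SmoothRing.
Variables (R : realType) (n : nat) (U : set 'rV[R]_n) (oU : open U).
Local Notation T := {x : 'rV[R]_n | U x}.

(** Directional derivatives are defined for functions on the whole space.  The
    value off [U] is irrelevant since only germs at points of [U] are used. *)
Definition ext0 (h : T -> R) (y : 'rV[R]_n) : R :=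
  if pselect (U y) is left p then h (exist _ y p) else 0.

Lemma ext0E h (p : T) : ext0 h (sval p) = h p.
Proof.
rewrite /ext0; case: pselect => [q|]; last by case: p.
by congr (h _); case: p q => y p q /=; congr (exist _ y _); exact: Prop_irrelevance.
Qed.

Lemma ext0_restr (f : 'rV[R]_n -> R) x : U x -> ext0 (fun p : T => f (sval p)) x = f x.
Proof. by move=> Ux; rewrite (ext0E _ (exist _ x Ux)). Qed.

(** Openness of [U] is recorded as an index because the closure of this
    predicate under ring operations depends on it; otherwise the ring structure
    on [smoothFun] could not be inferred. *)
Definition smooth_pred : {pred T -> R} := let _ := oU in fun h => `[< smooth_on U (ext0 h) >].

Lemma smooth_predP h : reflect (smooth_on U (ext0 h)) (h \in smooth_pred).
Proof. exact: asboolP. Qed.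

Lemma smooth_pred_subring : subring_closed smooth_pred.
Proof.
split.
- apply/smooth_predP => k; have C : Ck k U (cst 1 : 'rV[R]_n -> R) by exact: Ck_cst.
  by apply: (Ck_ext oU _ C) => x Ux; rewrite (ext0E _ (exist _ x Ux)).
- move=> f g /smooth_predP sf /smooth_predP sg; apply/smooth_predP => k.
  apply: (Ck_ext oU _ (CkD oU (sf k) (CkN oU (sg k)))) => x Ux /=.
  by rewrite !(ext0E _ (exist _ x Ux)).
- move=> f g /smooth_predP sf /smooth_predP sg; apply/smooth_predP => k.
  apply: (Ck_ext oU _ (CkM oU (sf k) (sg k))) => x Ux /=.
  by rewrite !(ext0E _ (exist _ x Ux)).
Qed.

Record smoothFun := SmoothFun { smooth_val :> T -> R; smooth_valP : smooth_val \in smooth_pred }.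
HB.instance Definition _ := [isSub for smooth_val].
HB.instance Definition _ := [Choice of smoothFun by <:].
HB.instance Definition _ :=
  GRing.SubChoice_isSubComPzRing.Build (T -> R) smooth_pred smoothFun smooth_pred_subring.

Implicit Types (f g : smoothFun) (p : T).

Lemma smoothE f g : (forall p, f p = g p) -> f = g.
Proof. by move=> fg; apply: val_inj; apply: funext. Qed.

Lemma evD f g p : (f + g) p = f p + g p. Proof. by []. Qed.
Lemma evM f g p : (f * g) p = f p * g p. Proof. by []. Qed.
Lemma evN f p : (- f) p = - f p. Proof. by []. Qed.
Lemma ev0 p : (0 : smoothFun) p = 0. Proof. by []. Qed.
Lemma ev1 p : (1 : smoothFun) p = 1. Proof. by []. Qed.
Lemma evB f g p : (f - g) p = f p - g p. Proof. by []. Qed.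
Lemma ev_sum (I : Type) (r : seq I) (P : pred I) (F : I -> smoothFun) p :
  (\sum_(i <- r | P i) F i) p = \sum_(i <- r | P i) F i p.
Proof. exact: (big_morph (fun f : smoothFun => f p) (fun f g => evD f g p) (ev0 p)). Qed.
Lemma ev_nat k p : (k%:R : smoothFun) p = k%:R.
Proof. by elim: k => // k IH; rewrite !mulrS evD IH. Qed.

Lemma smooth_ext0 f : smooth_on U (ext0 f).
Proof. exact/smooth_predP/smooth_valP. Qed.

Definition restr (f : 'rV[R]_n -> R) (sf : smooth_on U f) : smoothFun.
Proof.
exists (fun p : T => f (sval p)); apply/smooth_predP => k.
by apply: (Ck_ext oU _ (sf k)) => x Ux; rewrite ext0_restr.
Defined.

Lemma smooth_on_partial a f : smooth_on U (fun y => 'D_(delta_mx 0 a) (ext0 f) y).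
Proof. by move=> k; have [_] := smooth_ext0 f k.+1; exact. Qed.

Definition smooth_pd a f : smoothFun := restr (smooth_on_partial a f).

Lemma ext0_near (h : T -> R) (f : 'rV[R]_n -> R) x : U x ->
  (forall p, h p = f (sval p)) -> {near x, ext0 h =1 f}.
Proof.
move=> Ux hf; near=> y; have Uy : U y by near: y; exact: open_nbhs_nbhs.
by rewrite (ext0E _ (exist _ y Uy)) hf.
Unshelve. all: by end_near. Qed.

Lemma ext0_differentiable f x : U x -> differentiable (ext0 f) x.
Proof. by have [d _] := smooth_ext0 f 1; exact: d. Qed.

Lemma smooth_pdE a f (h : 'rV[R]_n -> R) p : (forall q, f q = h (sval q)) ->
  smooth_pd a f p = partial a h (sval p).
Proof. by move=> fh; apply: near_eq_derive; apply: ext0_near => //; case: p. Qed.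

(** Linearity of the differential in the direction. *)
Lemma derive_smooth_pd f (h : 'rV[R]_n -> R) v p : (forall q, f q = h (sval q)) ->
  'D_v h (sval p) = \sum_a v 0 a * smooth_pd a f p.
Proof.
move=> fh; have Up : U (sval p) by case: p.
have df := ext0_differentiable f Up.
transitivity ('D_v (ext0 f) (sval p)).
  by apply: near_eq_derive; have := ext0_near Up fh; apply: filterS => y ->.
rewrite deriveE // {1}(row_sum_delta v) linear_sum; apply: eq_bigr => a _.
by rewrite linearZ /= -deriveE.
Qed.

Lemma smooth_pdD a f g : smooth_pd a (f + g) = smooth_pd a f + smooth_pd a g.
Proof.
apply: smoothE => p; have Up : U (sval p) by case: p.
rewrite (@smooth_pdE _ _ (ext0 f \+ ext0 g)) => [|q]; last by rewrite /= !ext0E.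
by rewrite /partial deriveD //; apply/diff_derivable/ext0_differentiable.
Qed.

Lemma smooth_pdM a f g : smooth_pd a (f * g) = smooth_pd a f * g + f * smooth_pd a g.
Proof.
apply: smoothE => p; have Up : U (sval p) by case: p.
rewrite (@smooth_pdE _ _ (ext0 f \* ext0 g)) => [|q]; last by rewrite /= !ext0E.
rewrite /partial deriveM; try by apply/diff_derivable/ext0_differentiable.
by rewrite !ext0E evD !evM [RHS]addrC [X in _ + X]mulrC.
Qed.

Lemma smooth_pdC a b f : smooth_pd a (smooth_pd b f) = smooth_pd b (smooth_pd a f).
Proof.
apply: smoothE => p; have Up : U (sval p) by case: p.
have E c d : smooth_pd c (smooth_pd d f) p = partial c (fun y =>
    'D_(delta_mx 0 d) (ext0 f) y) (sval p).
  exact: smooth_pdE.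
rewrite !E; exact: (derive_comm _ _ oU Up (smooth_ext0 f 2)).
Qed.

Lemma smooth_torsion_free k f : k.+1%:R * f = 0 -> f = 0.
Proof.
move=> H; apply: smoothE => p; have := congr1 (fun g : smoothFun => g p) H.
rewrite evM ev_nat ev0 => /eqP; rewrite mulf_eq0 pnatr_eq0 /= => /eqP ->.
by [].
Qed.

Lemma smooth_on_cst (a : R) : smooth_on U (cst a : 'rV[R]_n -> R).
Proof. by move=> k; exact: Ck_cst. Qed.
Definition const_fun a : smoothFun := restr (smooth_on_cst a).
Lemma ev_const a p : const_fun a p = a. Proof. by []. Qed.
End SmoothRing.

(** * Trace of the Weyl part of a curvature array *)

Section WeylAlgebra.
Variables (F : comPzRingType) (n : nat).
Local Notation array2 := ('I_n -> 'I_n -> F).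
Local Notation array4 := ('I_n -> 'I_n -> 'I_n -> 'I_n -> F).

Definition scalar_curv (T : array4) := \sum_i ricci T i i.
(** The Schouten tensor when al = 1/(n-2) and ga = 1/(2(n-1)(n-2)).  These
    constants are arguments because the ring need not contain inverses. *)
Definition schouten (al ga : F) (T : array4) : array2 := fun i j =>
  al * ricci T i j - scalar_curv T * ga * (i == j)%:R.

Lemma ricci_KN_delta (A : array2) i k :
  ricci (KN_delta A) i k = (n%:R - 2) * A i k + (i == k)%:R * \sum_j A j j.
Proof.
rewrite /ricci /KN_delta !sumrB big_split /= -!mulr_sumr sum_kd_diag.
rewrite (sum_kd (fun j => A i j)).
under [X in _ - X = _]eq_bigr do rewrite mulrC kdC.
rewrite (sum_kd (fun j => A j k)); ring.
Qed.

Lemma weyl_trace_free (al ga : F) (T : array4) :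
  al * (n%:R - 2) = 1 -> ga * (2 * n%:R - 2) = al ->
  forall i k, \sum_j (T i j k j - KN_delta (schouten al ga T) i j k j) = 0.
Proof.
move=> hal hga i k; rewrite sumrB -/(ricci T i k).
rewrite -/(ricci (KN_delta (schouten al ga T)) i k) ricci_KN_delta /schouten sumrB -!mulr_sumr.
rewrite sum_kd_diag -/(scalar_curv T).
set S := scalar_curv T; set d := (_ == _)%:R; set r := ricci T i k.
transitivity (r - (al * (n%:R - 2)) * r + d * S * (ga * (2 * n%:R - 2) - al)); first by ring.
by rewrite hal hga; ring.
Qed.
End WeylAlgebra.

(** * From tensor fields to arrays of smooth functions *)

Section Bridge.
Variables (R : realType) (n : nat) (U : set 'rV[R]_n) (oU : open U).
Variables (G : 'rV[R]_n -> 'M[R]_n) (e : 'I_n -> 'rV[R]_n -> 'rV[R]_n).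
Hypothesis sG : smooth_on U G.
Hypothesis symG : forall x, U x -> (G x)^T = G x.
Hypothesis onf : orthonormal_frame G U e.

Local Notation F := (smoothFun oU).
Local Notation T := {x : 'rV[R]_n | U x}.
Local Notation vfield := ('rV[R]_n -> 'rV[R]_n).
Local Notation tensor2 := (vfield -> vfield -> 'rV[R]_n -> R).
Local Notation tensor4 := (vfield -> vfield -> vfield -> vfield -> 'rV[R]_n -> R).
Local Notation array2 := ('I_n -> 'I_n -> F).
Local Notation array4 := ('I_n -> 'I_n -> 'I_n -> 'I_n -> F).

Lemma gram_entry_smooth a b : smooth_on U (fun x => G x a b : R).
Proof. by move=> k; apply: Ck_coord oU (sG k). Qed.

Lemma frame_entry_smooth i a : smooth_on U (fun x => e i x 0 a : R).
Proof. by move=> k; apply: Ck_coord oU (onf.1 i k). Qed.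

Definition gram_fun a b : F := restr oU (gram_entry_smooth a b).
Definition frame_fun i a : F := restr oU (frame_entry_smooth i a).
Definition half_fun : F := const_fun oU 2^-1.
Local Notation dx := (@smooth_pd _ _ _ oU).
Local Notation D := (frame_der dx frame_fun).
Local Notation om := (frame_om dx half_fun gram_fun frame_fun).

Lemma innerE (A : 'M[R]_n) u v : inner A u v = \sum_a \sum_b u 0 a * A a b * v 0 b.
Proof.
rewrite /inner mxE exchange_big; apply: eq_bigr => b _ /=.
by rewrite !mxE mulr_suml.
Qed.

Lemma halfK : 2 * half_fun = 1.
Proof. by apply: smoothE => p; rewrite evM ev_nat /= divff ?pnatr_eq0. Qed.

Lemma gram_fun_sym a b : gram_fun a b = gram_fun b a.
Proof. by apply: smoothE => -[x Ux] /=; rewrite -{1}(symG Ux) mxE. Qed.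

Lemma frame_fun_orth i j : \sum_a \sum_b frame_fun i a * gram_fun a b * frame_fun j b = (i == j)%:R.
Proof.
apply: smoothE => -[x Ux]; rewrite ev_nat -(onf.2 x Ux i j) innerE ev_sum.
by apply: eq_bigr => a _; rewrite ev_sum.
Qed.

Definition frame_mx x : 'M[R]_n := \matrix_(i, a) e i x 0 a.

(** Orthonormality says E G E^T = 1; a one-sided inverse of a square matrix is
    two-sided, so G is invertible with inverse E^T E. *)
Lemma gram_cometric x : U x -> G x *m ((frame_mx x)^T *m frame_mx x) = 1%:M.
Proof.
move=> Ux; apply: mulmx1C; rewrite -mulmxA; apply: mulmx1C.
apply/matrixP => i j; rewrite !mxE -(onf.2 x Ux i j) innerE exchange_big.
by apply: eq_bigr => b _ /=; rewrite !mxE mulr_suml; apply: eq_bigr => a _; rewrite !mxE.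
Qed.

Lemma cometricE x p : U x -> x = sval p -> forall a b, cometric frame_fun a b p =
    ((frame_mx x)^T *m frame_mx x) a b.
Proof.
move=> Ux -> a b; rewrite mxE ev_sum; apply: eq_bigr => i _.
by rewrite !mxE.
Qed.

Lemma frame_fun_cometricK a c : \sum_b gram_fun a b * cometric frame_fun b c = (a == c)%:R.
Proof.
apply: smoothE => -[x Ux]; rewrite ev_nat ev_sum.
have /matrixP/(_ a c) := gram_cometric Ux; rewrite !mxE => <-.
by apply: eq_bigr => b _; rewrite evM (cometricE Ux).
Qed.

Lemma invmx_gram x : U x -> invmx (G x) = (frame_mx x)^T *m frame_mx x.
Proof.
move=> Ux; have H := gram_cometric Ux; have [uG _] := mulmx1_unit H.
by rewrite -[RHS](mulKmx uG) H mulmx1.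
Qed.

Lemma smooth_pd_gram a b c (p : T) : dx a (gram_fun b c) p = partial a (fun y => G y b c) (sval p).
Proof. exact: smooth_pdE. Qed.

Lemma christoffelE (p : T) k i j : christoffel G (sval p) k i j =
    coord_chr dx half_fun gram_fun frame_fun k i j p.
Proof.
case: p => x Ux; rewrite /coord_chr evM ev_sum; congr (_ * _); apply: eq_bigr => l _.
by rewrite evM (invmx_gram Ux) (cometricE (x := x)) // evB evD !smooth_pd_gram.
Qed.

Let DxD := @smooth_pdD R n U oU.
Let DxM := @smooth_pdM R n U oU.
Let DxC := @smooth_pdC R n U oU.
Let DD := frame_derD DxD frame_fun.
Let DM := frame_derM DxM frame_fun.
Let om_anti := frame_om_anti DxD DxM halfK gram_fun_sym frame_fun_orth frame_fun_cometricK.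
Let dcomm := frame_der_comm DxD DxM DxC half_fun gram_fun_sym frame_fun_cometricK.
Let jacobi := frame_jacobi DxD DxM DxC half_fun gram_fun_sym frame_fun_orth frame_fun_cometricK.

(** [X] equals the combination of the frame with smooth coefficients [a] on
    [U]; nothing is asked off [U]. *)
Definition has_comps (X : vfield) (a : 'I_n -> F) :=
  forall p al, X (sval p) 0 al = vec_of frame_fun a al p.

Definition unit_coef k : 'I_n -> F := fun i => (i == k)%:R.

Lemma frame_comps k : has_comps (e k) (unit_coef k).
Proof.
move=> p al; rewrite /vec_of /unit_coef; under eq_bigr do rewrite mulrC.
by rewrite (sum_kd (fun i => frame_fun i al)).
Qed.

Lemma vfield_derivable X a (p : T) v : has_comps X a -> derivable X (sval p) v.
Proof.
move=> Xa; apply/derivable_mxP => i al; rewrite ord1.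
have Up : U (sval p) by case: p.
apply: (@near_eq_derivable _ _ _ (ext0 (vec_of frame_fun a al))).
  by apply: ext0_near => // q; rewrite Xa.
exact/diff_derivable/ext0_differentiable.
Qed.

Lemma derive_vfield X a (p : T) v al : has_comps X a ->
  ('D_v X (sval p)) 0 al = \sum_k v 0 k * dx k (vec_of frame_fun a al) p.
Proof.
move=> Xa; rewrite derive_mx; last exact: vfield_derivable Xa.
by rewrite mxE; apply: derive_smooth_pd => q; rewrite Xa.
Qed.

Lemma nabla_comps X Y a b : has_comps X a -> has_comps Y b ->
  has_comps (nabla G X Y) (nabla_coef D om a b).
Proof.
move=> Xa Yb p al; rewrite -(vec_nabla DxD DxM half_fun frame_fun_cometricK).
rewrite /nabla !mxE (derive_vfield _ _ _ Yb) evD !ev_sum; congr (_ + _).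
  by apply: eq_bigr => k _; rewrite evM Xa.
apply: eq_bigr => k _; rewrite ev_sum; apply: eq_bigr => l _.
by rewrite evM evM christoffelE Xa Yb.
Qed.

Lemma compsB X Y a b : has_comps X a -> has_comps Y b ->
  has_comps (fun x => X x - Y x) (fun q => a q - b q).
Proof.
move=> Xa Yb p al; rewrite !mxE Xa Yb -evB.
have -> // : vec_of frame_fun (fun q => a q - b q) al =
    vec_of frame_fun a al - vec_of frame_fun b al.
by rewrite /vec_of -sumrB; apply: eq_bigr => i _; rewrite mulrBl.
Qed.

Lemma lie_bracketE X Y (p : T) : lie_bracket X Y (sval p) =
    nabla G X Y (sval p) - nabla G Y X (sval p).
Proof.
have E : \row_k (\sum_i \sum_j christoffel G (sval p) k i j * X (sval p) 0 i * Y (sval p) 0 j) =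
  \row_k (\sum_i \sum_j christoffel G (sval p) k i j * Y (sval p) 0 i * X (sval p) 0 j).
  apply/rowP => k; rewrite !mxE exchange_big /=.
  apply: eq_bigr => i _; apply: eq_bigr => j _.
  by rewrite !christoffelE (coord_chr_sym _ _ _ gram_fun_sym) mulrAC.
by rewrite /lie_bracket /nabla E opprD addrACA subrr addr0.
Qed.

Lemma lie_comps X Y a b : has_comps X a -> has_comps Y b ->
  has_comps (lie_bracket X Y) (fun q => nabla_coef D om a b q - nabla_coef D om b a q).
Proof.
move=> Xa Yb p al; rewrite lie_bracketE.
exact: (compsB (nabla_comps Xa Yb) (nabla_comps Yb Xa)).
Qed.

Lemma curvature_comps X Y Z a b t : has_comps X a -> has_comps Y b -> has_comps Z t ->
  has_comps (curvature G X Y Z)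
   (fun q => \sum_i \sum_j \sum_l frame_riem D om i j q l * a i * b j * t l).
Proof.
move=> Xa Yb Zt p al.
rewrite /curvature.
have H := compsB (compsB (nabla_comps Xa (nabla_comps Yb Zt)) (nabla_comps Yb (nabla_comps Xa Zt)))
  (nabla_comps (lie_comps Xa Yb) Zt).
have E : vec_of frame_fun (fun q => \sum_i \sum_j \sum_l frame_riem D om i j q l * a i * b j * t l) al = vec_of frame_fun
    (fun q => nabla_coef D om a (nabla_coef D om b t) q - nabla_coef D om b (nabla_coef D om a t) q
       - nabla_coef D om (fun p => nabla_coef D om a b p - nabla_coef D om b a p) t q) al.
  by apply: eq_bigr => q _; rewrite (nabla_coef_curv DD DM dcomm).
by rewrite E; exact: H.
Qed.

Lemma inner_comps X Y a b (p : T) : has_comps X a -> has_comps Y b ->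
  inner (G (sval p)) (X (sval p)) (Y (sval p)) = (\sum_i a i * b i) p.
Proof.
move=> Xa Yb; rewrite innerE -(vec_inner frame_fun_orth) ev_sum.
by apply: eq_bigr => k _; rewrite ev_sum; apply: eq_bigr => l _; rewrite evM evM Xa Yb.
Qed.

Definition tens2 (h : tensor2) (H : array2) := forall X Y a b (p : T),
  has_comps X a -> has_comps Y b -> h X Y (sval p) = (\sum_i \sum_j H i j * a i * b j) p.

(** [A] depends on its arguments only through their frame components, and
    multilinearly, with the array [H] as values on the frame. *)
Definition tens4 (A : tensor4) (H : array4) := forall X Y Z V a b z t (p : T),
  has_comps X a -> has_comps Y b -> has_comps Z z -> has_comps V t ->
  A X Y Z V (sval p) = (\sum_i \sum_j \sum_k \sum_l H i j k l * a i * b j * z k * t l) p.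

Lemma tens4_riem : tens4 (Riem G) (frame_riem D om).
Proof.
move=> X Y Z V a b z t p Xa Yb Zz Vt.
rewrite /Riem (inner_comps _ (curvature_comps Xa Yb Vt) Zz).
have -> // : \sum_q (\sum_i \sum_j \sum_l frame_riem D om i j q l * a i * b j * t l) * z q =
  \sum_i \sum_j \sum_k \sum_l frame_riem D om i j k l * a i * b j * z k * t l.
under eq_bigr do rewrite mulr_suml.
rewrite exchange_big; apply: eq_bigr => i _ /=.
under eq_bigr do rewrite mulr_suml.
rewrite exchange_big; apply: eq_bigr => j _ /=.
apply: eq_bigr => k _; rewrite mulr_suml; apply: eq_bigr => l _; exact: mulrAC.
Qed.

Lemma tens2_metric : tens2 (metric_tensor G) (fun i j => (i == j)%:R).
Proof.
move=> X Y a b p Xa Yb; rewrite /metric_tensor (inner_comps _ Xa Yb).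
have -> // : \sum_i a i * b i = \sum_i \sum_j (i == j)%:R * a i * b j.
apply: eq_bigr => i _; rewrite -(sum_kdl (fun j => a i * b j)).
by apply: eq_bigr => j _; rewrite mulrC mulrA.
Qed.

Lemma sum_delta (f : 'I_n -> F) k : \sum_i f i * unit_coef k i = f k.
Proof. exact: sum_kd. Qed.

Lemma tens2_frame h H i j (p : T) : tens2 h H -> h (e i) (e j) (sval p) = H i j p.
Proof.
move=> hH; rewrite (hH _ _ _ _ p (frame_comps i) (frame_comps j)).
have -> // : \sum_k \sum_l H k l * unit_coef i k * unit_coef j l = H i j.
under eq_bigr do rewrite (sum_delta (fun l => H _ l * unit_coef i _)).
by rewrite (sum_delta (fun k => H k j)).
Qed.

(** The slot lemmas evaluate a tensor on three frame fields and one general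
    field, as needed for the correction terms of a covariant derivative. *)
Lemma tens4_slot1 A H X a j k l (p : T) : tens4 A H -> has_comps X a ->
  A X (e j) (e k) (e l) (sval p) = (\sum_i a i * H i j k l) p.
Proof.
move=> AH Xa; rewrite (AH _ _ _ _ _ _ _ _ p Xa (frame_comps j) (frame_comps k) (frame_comps l)).
have -> // : \sum_u \sum_v \sum_w \sum_x H u v w x * a u * unit_coef j v * unit_coef k w * unit_coef l x =
  \sum_i a i * H i j k l.
apply: eq_bigr => i _.
under eq_bigr => v _ do under eq_bigr => w _ do
  rewrite (sum_delta (fun x => H i v w x * a i * unit_coef j v * unit_coef k w)).
under eq_bigr => v _ do rewrite (sum_delta (fun w => H i v w l * a i * unit_coef j v)).
by rewrite (sum_delta (fun v => H i v k l * a i)) mulrC.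
Qed.

Lemma tens4_slot2 A H X a i k l (p : T) : tens4 A H -> has_comps X a ->
  A (e i) X (e k) (e l) (sval p) = (\sum_j a j * H i j k l) p.
Proof.
move=> AH Xa; rewrite (AH _ _ _ _ _ _ _ _ p (frame_comps i) Xa (frame_comps k) (frame_comps l)).
have -> // : \sum_u \sum_v \sum_w \sum_x H u v w x * unit_coef i u * a v * unit_coef k w * unit_coef l x =
  \sum_j a j * H i j k l.
rewrite exchange_big; apply: eq_bigr => v _ /=.
under eq_bigr => u _ do under eq_bigr => w _ do
  rewrite (sum_delta (fun x => H u v w x * unit_coef i u * a v * unit_coef k w)).
under eq_bigr => u _ do rewrite (sum_delta (fun w => H u v w l * unit_coef i u * a v)) mulrAC.
by rewrite (sum_delta (fun u => H u v k l * a v)) mulrC.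
Qed.

Lemma tens4_slot3 A H X a i j l (p : T) : tens4 A H -> has_comps X a ->
  A (e i) (e j) X (e l) (sval p) = (\sum_k a k * H i j k l) p.
Proof.
move=> AH Xa; rewrite (AH _ _ _ _ _ _ _ _ p (frame_comps i) (frame_comps j) Xa (frame_comps l)).
have -> // : \sum_u \sum_v \sum_w \sum_x H u v w x * unit_coef i u * unit_coef j v * a w * unit_coef l x =
  \sum_k a k * H i j k l.
under eq_bigr => u _ do under eq_bigr => v _ do under eq_bigr => w _ do
  rewrite (sum_delta (fun x => H u v w x * unit_coef i u * unit_coef j v * a w)).
under eq_bigr => u _ do (rewrite exchange_big /=; under eq_bigr => w _ do
  (under eq_bigr => v _ do rewrite mulrAC; rewrite (sum_delta (fun v =>
      H u v w l * unit_coef i u * a w)))).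
rewrite exchange_big; apply: eq_bigr => w _ /=.
under eq_bigr => u _ do rewrite mulrAC.
by rewrite (sum_delta (fun u => H u j w l * a w)) mulrC.
Qed.

Lemma tens4_slot4 A H X a i j k (p : T) : tens4 A H -> has_comps X a ->
  A (e i) (e j) (e k) X (sval p) = (\sum_l a l * H i j k l) p.
Proof.
move=> AH Xa; rewrite (AH _ _ _ _ _ _ _ _ p (frame_comps i) (frame_comps j) (frame_comps k) Xa).
have -> // : \sum_u \sum_v \sum_w \sum_x H u v w x * unit_coef i u * unit_coef j v * unit_coef k w * a x =
  \sum_l a l * H i j k l.
pose K u v w := \sum_x a x * H u v w x.
transitivity (\sum_u (\sum_v (\sum_w K u v w * unit_coef k w) * unit_coef j v) * unit_coef i u).
  apply: eq_bigr => u _; rewrite mulr_suml; apply: eq_bigr => v _; rewrite !mulr_suml.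
  apply: eq_bigr => w _; rewrite /K !mulr_suml; apply: eq_bigr => x _; ring.
under eq_bigr => u _ do (under eq_bigr => v _ do rewrite sum_delta; rewrite sum_delta).
by rewrite (sum_delta (fun u => K u j k)).
Qed.

Lemma tens4_frame A H i j k l (p : T) : tens4 A H ->
  A (e i) (e j) (e k) (e l) (sval p) = H i j k l p.
Proof.
move=> AH; rewrite (tens4_slot1 _ _ _ _ AH (frame_comps i)).
by under eq_bigr do rewrite mulrC; rewrite (sum_delta (fun i => H i j k l)).
Qed.

Lemma tens2_ric : tens2 (Ric G e) (ricci (frame_riem D om)).
Proof.
move=> X Z a z p Xa Zz; rewrite /Ric.
under eq_bigr => j _ do rewrite (tens4_riem p Xa (frame_comps j) Zz (frame_comps j)).
rewrite -ev_sum.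
have -> // : \sum_j \sum_i \sum_v \sum_k \sum_l frame_riem D om i v k l * a i * unit_coef j v * z k * unit_coef j l =
  \sum_i \sum_k ricci (frame_riem D om) i k * a i * z k.
rewrite exchange_big; apply: eq_bigr => i _ /=.
transitivity (\sum_j \sum_k frame_riem D om i j k j * a i * z k).
  apply: eq_bigr => j _.
  transitivity (\sum_v (\sum_k \sum_l frame_riem D om i v k l * a i * z k * unit_coef j l) * unit_coef j v).
    apply: eq_bigr => v _; rewrite mulr_suml; apply: eq_bigr => k _.
    by rewrite mulr_suml; apply: eq_bigr => l _; ring.
  rewrite sum_delta; apply: eq_bigr => k _.
  by rewrite (sum_delta (fun l => frame_riem D om i j k l * a i * z k)).
rewrite exchange_big; apply: eq_bigr => k _ /=.
by rewrite /ricci !mulr_suml.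
Qed.

Lemma scalE (p : T) : scal G e (sval p) = scalar_curv (frame_riem D om) p.
Proof.
by rewrite /scal /scalar_curv ev_sum; apply: eq_bigr => i _; rewrite (tens2_frame _ _ _ tens2_ric).
Qed.

Lemma sum4_prod (P Q : array2) (a b z t : 'I_n -> F) :
  \sum_i \sum_j \sum_k \sum_l P i k * Q j l * a i * b j * z k * t l =
  (\sum_i \sum_k P i k * a i * z k) * (\sum_j \sum_l Q j l * b j * t l).
Proof.
rewrite mulr_suml; apply: eq_bigr => i _; rewrite mulr_suml exchange_big; apply: eq_bigr => k _ /=.
rewrite mulr_sumr; apply: eq_bigr => j _; rewrite mulr_sumr; apply: eq_bigr => l _; ring.
Qed.

Lemma tens4_KN h H : tens2 h H -> tens4 (KN h (metric_tensor G)) (KN_delta H).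
Proof.
move=> hH X Y Z V a b z t p Xa Yb Zz Vt.
rewrite /KN (hH _ _ _ _ p Xa Zz) (hH _ _ _ _ p Yb Vt) (hH _ _ _ _ p Xa Vt) (hH _ _ _ _ p Yb Zz).
rewrite (tens2_metric p Xa Zz) (tens2_metric p Yb Vt) (tens2_metric p Xa Vt) (tens2_metric p Yb Zz).
rewrite -!evM -evD -!evB; congr (smooth_val _ p).
pose K : array2 := fun i j => (i == j)%:R.
rewrite -(sum4_prod H K) -(sum4_prod K H).
have S (P Q : array2) : \sum_i \sum_j \sum_k \sum_l P i l * Q j k * a i * b j * z k * t l =
  (\sum_i \sum_k P i k * a i * t k) * (\sum_j \sum_l Q j l * b j * z l).
  rewrite -sum4_prod; apply: eq_bigr => i _; apply: eq_bigr => j _.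
  rewrite exchange_big; do 2! (apply: eq_bigr => ? _); ring.
rewrite -(S H K) -(S K H).
rewrite -big_split -!sumrB /=; apply: eq_bigr => i _.
rewrite -big_split -!sumrB /=; apply: eq_bigr => j _.
rewrite -big_split -!sumrB /=; apply: eq_bigr => k _.
rewrite -big_split -!sumrB /=; apply: eq_bigr => l _.
by rewrite /KN_delta /K; ring.
Qed.

Definition ricci_weight : F := const_fun oU (n%:R - 2)^-1.
Definition scal_weight : F := const_fun oU (2 * (n%:R - 1) * (n%:R - 2))^-1.
Definition schouten_fun : array2 := schouten ricci_weight scal_weight (frame_riem D om).
Definition weyl_fun : array4 := fun i j k l =>
    frame_riem D om i j k l - KN_delta schouten_fun i j k l.

Lemma tens4_weyl : tens4 (Weyl G e) weyl_fun.
Proof.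
move=> X Y Z V a b z t p Xa Yb Zz Vt.
rewrite /Weyl (tens4_riem p Xa Yb Zz Vt) (tens4_KN tens2_ric p Xa Yb Zz Vt).
rewrite (tens4_KN tens2_metric p Xa Yb Zz Vt) scalE.
set S := scalar_curv _.
pose M (A : array4) := \sum_i \sum_j \sum_k \sum_l A i j k l * a i * b j * z k * t l.
have -> : S p / (2 * (n%:R - 1) * (n%:R - 2)) = (S * scal_weight) p by [].
have -> : (n%:R - 2)^-1 = ricci_weight p by [].
rewrite -/(M (frame_riem D om)) -/(M (KN_delta _)) -/(M (KN_delta _)) -!evM -evB -evD;
    congr (smooth_val _ p).
rewrite -/(M weyl_fun) /M !mulr_sumr -sumrB -big_split /=; apply: eq_bigr => i _.
rewrite !mulr_sumr -sumrB -big_split /=; apply: eq_bigr => j _.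
rewrite !mulr_sumr -sumrB -big_split /=; apply: eq_bigr => k _.
rewrite !mulr_sumr -sumrB -big_split /=; apply: eq_bigr => l _.
rewrite /weyl_fun /schouten_fun /schouten /KN_delta -/S.
by move: (ricci _) (frame_riem _ _ _ _ _ _) S ricci_weight scal_weight (a i) (b j) (z k) (t l) =>
    *; ring.
Qed.

Lemma nabla_frame_comps m i : has_comps (nabla G (e m) (e i)) (fun q => om m q i).
Proof.
move=> p al; rewrite (nabla_comps (frame_comps m) (frame_comps i)).
have -> // : vec_of frame_fun (nabla_coef D om (unit_coef m) (unit_coef i)) al =
    vec_of frame_fun (fun q => om m q i) al.
apply: eq_bigr => q _; congr (_ * _).
rewrite /nabla_coef; under eq_bigr do rewrite mulrC.
rewrite sum_delta /cov1 (der_nat DD DM) add0r.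
exact: (sum_delta (fun p => om m q p)).
Qed.

Lemma frame_derE m (f : F) (h : 'rV[R]_n -> R) (p : T) : (forall q, f q = h (sval q)) ->
  'D_(e m (sval p)) h (sval p) = D m f p.
Proof.
move=> fh; rewrite (derive_smooth_pd _ _ fh) ev_sum.
by apply: eq_bigr => a _; rewrite evM.
Qed.

(** The definition subtracts A(nabla e, ...); as [om] is skew, this is the
    addition of the terms of [cov4]. *)
Lemma nabla4_frame A H m i j k l (p : T) : tens4 A H ->
  nabla4 G (e m) A (e i) (e j) (e k) (e l) (sval p) = cov4 D om m H i j k l p.
Proof.
move=> AH.
have nf := nabla_frame_comps m.
rewrite /nabla4 (tens4_slot1 _ _ _ p AH (nf i)) (tens4_slot2 _ _ _ p AH (nf j)).
rewrite (tens4_slot3 _ _ _ p AH (nf k)) (tens4_slot4 _ _ _ p AH (nf l)).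
rewrite (@frame_derE m (H i j k l)); last by move=> q; rewrite (tens4_frame _ _ _ _ q AH).
rewrite -!evB; congr (smooth_val _ p).
have N u (f : 'I_n -> F) : - \sum_q om m q u * f q = \sum_q om m u q * f q.
  by rewrite -sumrN; apply: eq_bigr => q _; rewrite om_anti mulNr opprK.
by rewrite !N.
Qed.

Lemma nabla_weylE m i j k l (p : T) :
  nabla_weyl_comps G e (sval p) m i j k l = cov4 D om m weyl_fun i j k l p.
Proof. exact: nabla4_frame tens4_weyl. Qed.

Lemma weyl_compsE i j k l (p : T) : weyl_comps G e (sval p) i j k l = weyl_fun i j k l p.
Proof. exact: tens4_frame tens4_weyl. Qed.

Lemma laplacianE (f : 'rV[R]_n -> R) (phi : F) (p : T) : (forall q, phi q = f (sval q)) ->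
  laplacian G e f (sval p) = (\sum_i (D i (D i phi) + \sum_q om i i q * D q phi)) p.
Proof.
move=> ff; rewrite /laplacian ev_sum; apply: eq_bigr => i _; rewrite /hessian evD.
rewrite (@frame_derE i (D i phi)); last by move=> q; rewrite (frame_derE _ _ ff).
congr (_ + _); rewrite (derive_smooth_pd _ _ ff).
under eq_bigr do rewrite nabla_frame_comps -evM.
rewrite -ev_sum -evN; congr (smooth_val _ p).
rewrite /vec_of; under eq_bigr do rewrite mulr_suml.
rewrite exchange_big -sumrN; apply: eq_bigr => q _ /=.
rewrite (om_anti i i q) mulNr; congr (- _).
by rewrite /frame_der mulr_sumr; apply: eq_bigr => a _; rewrite mulrA.
Qed.

Hypothesis n4 : (4 <= n)%N.
Hypothesis div0 : forall x, U x -> forall i j k, div_weyl G e x i j k = 0.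

Lemma weyl_fun_div i j k : \sum_m cov4 D om m weyl_fun i j k m = 0.
Proof.
apply: smoothE => p; rewrite ev_sum -[RHS](div0 (svalP p) i j k).
by apply: eq_bigr => m _; rewrite -nabla_weylE.
Qed.

Lemma weyl_fun_trace_free i k : \sum_j weyl_fun i j k j = 0.
Proof.
have n2 : (n%:R - 2 : R) != 0.
  by rewrite subr_eq0 eqr_nat; case: (n) n4 => [|[|[|]]].
have n1 : (n%:R - 1 : R) != 0.
  by rewrite subr_eq0 (eqr_nat _ _ 1); case: (n) n4 => [|[|]].
apply: weyl_trace_free; apply: smoothE => p.
  by rewrite evM evB !ev_nat ev1 /= mulVf.
rewrite evM evB evM !ev_nat /=.
by field; rewrite n1 n2.
Qed.

Lemma ricci_sym i j : ricci (frame_riem D om) i j = ricci (frame_riem D om) j i.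
Proof.
apply: eq_bigr => k _.
exact: (pair_sym (smooth_torsion_free (oU:=oU)) (frame_riem_curvature_like DD jacobi om_anti)).
Qed.

Lemma schouten_fun_sym i j : schouten_fun i j = schouten_fun j i.
Proof. by rewrite /schouten_fun /schouten ricci_sym eq_sym. Qed.

Lemma sum_lt_sym (f : 'I_n -> 'I_n -> R) : (forall a b, f a b = f b a) -> (forall a, f a a = 0) ->
  \sum_a \sum_b f a b = 2 * \sum_(a < n) \sum_(b < n | (a < b)%N) f a b.
Proof.
move=> fs f0; rewrite mulr_natl mulr2n.
rewrite [X in _ = _ + X](exchange_big_dep xpredT) //= -big_split; apply: eq_bigr => a _ /=.
rewrite (bigID (fun b : 'I_n => (a < b)%N)) /=; congr (_ + _).
rewrite (bigD1 a) ?ltnn //= f0 add0r.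
apply: eq_big => [b|b _]; last exact: fs.
by rewrite -leqNgt andbC -val_eqE /= ltn_neqAle.
Qed.

Lemma ev_dot4 (S S' : array4) (p : T) :
  dot4 S S' p = 4 * inner4 (fun i j k l => S i j k l p) (fun i j k l => S' i j k l p).
Proof.
rewrite /inner4 mulrA divff ?pnatr_eq0 // mul1r /dot4.
rewrite ev_sum; apply: eq_bigr => i _; rewrite ev_sum; apply: eq_bigr => j _.
rewrite ev_sum; apply: eq_bigr => k _; rewrite ev_sum; apply: eq_bigr => l _.
exact: evM.
Qed.

Lemma ev_sq2 (S : array4) (p : T) i j k l :
  sq4 (fun i j k l => S i j k l p) i j k l = 2^-1 * sq2 S i j k l p.
Proof.
rewrite /sq4 /sq2 ev_sum; congr (_ * _); apply: eq_bigr => q _; rewrite ev_sum.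
by apply: eq_bigr => r _; rewrite evM.
Qed.

Lemma ev_sharp (S : array4) (p : T) i j k l :
  sharp4 (fun i j k l => S i j k l p) i j k l = sharp S i j k l p.
Proof.
rewrite /sharp4 /sharp ev_sum; apply: eq_bigr => q _; rewrite ev_sum.
by apply: eq_bigr => r _; rewrite evB !evM.
Qed.

Lemma inner4D (A B C : 'I_n -> 'I_n -> 'I_n -> 'I_n -> R) a b :
  inner4 A (fun i j k l => a * B i j k l + b * C i j k l) = a * inner4 A B + b * inner4 A C.
Proof.
rewrite /inner4 mulrCA [b * _]mulrCA -mulrDr; congr (_ * _).
rewrite !mulr_sumr -big_split; apply: eq_bigr => i _ /=; rewrite !mulr_sumr -big_split; apply:
    eq_bigr => j _ /=.
rewrite !mulr_sumr -big_split; apply: eq_bigr => k _ /=.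
rewrite !mulr_sumr -big_split; apply: eq_bigr => l _ /=; ring.
Qed.

Lemma smooth_pd_cst a r : dx a (const_fun oU r) = 0.
Proof.
apply: smoothE => p; rewrite (@smooth_pdE _ _ _ _ _ _ (cst r)) // /partial.
exact: derive_cst.
Qed.

Lemma frame_der_scale i r f : D i (const_fun oU r * f) = const_fun oU r * D i f.
Proof.
rewrite DM /frame_der big1 ?mul0r ?add0r // => a _.
by rewrite smooth_pd_cst mulr0.
Qed.

Lemma frame_lap_scale r f :
  \sum_i (D i (D i (const_fun oU r * f)) + \sum_q om i i q * D q (const_fun oU r * f)) =
  const_fun oU r * \sum_i (D i (D i f) + \sum_q om i i q * D q f).
Proof.
rewrite [RHS]mulr_sumr; apply: eq_bigr => i _; rewrite !frame_der_scale mulrDr; congr (_ + _).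
by rewrite [RHS]mulr_sumr; apply: eq_bigr => q _; rewrite frame_der_scale mulrCA.
Qed.

Lemma weyl_compsE_fun (p : T) : weyl_comps G e (sval p) = fun i j k l => weyl_fun i j k l p.
Proof. by do 4! (apply: funext => ?); exact: weyl_compsE. Qed.

Lemma weyl_normsqE (p : T) : weyl_normsq G e (sval p) =
    (const_fun oU 4^-1 * dot4 weyl_fun weyl_fun) p.
Proof.
rewrite evM ev_const ev_dot4 mulrA mulVf ?pnatr_eq0 // mul1r.
by rewrite /weyl_normsq weyl_compsE_fun.
Qed.

(** Skewness in each pair makes the sum over increasing pairs a quarter of the
    full sum, which is the normalisation of [inner4]. *)
Lemma sum_lt_sym4 (X : 'I_n -> 'I_n -> 'I_n -> 'I_n -> R) :
    (forall a b c d, X a b c d = - X b a c d) -> (forall a b c d, X a b c d = - X a b d c) ->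
  \sum_(a < n) \sum_(b < n | (a < b)%N) \sum_(c < n) \sum_(d < n | (c < d)%N) X a b c d ^+ 2
  = inner4 X X.
Proof.
move=> Xl Xr.
have X0 a c d : X a a c d = 0.
  by apply/eqP; have /eqP := Xl a a c d; rewrite -addr_eq0 -mulr2n mulrn_eq0.
have X0r a b c : X a b c c = 0.
  by apply/eqP; have /eqP := Xr a b c c; rewrite -addr_eq0 -mulr2n mulrn_eq0.
pose f a b := \sum_(c < n) \sum_(d < n | (c < d)%N) X a b c d ^+ 2.
have -> : inner4 X X = 4^-1 * \sum_a \sum_b 2 * f a b.
  congr (_ * _); apply: eq_bigr => a _; apply: eq_bigr => b _.
  rewrite (sum_lt_sym (f := fun c d => X a b c d * X a b c d)) //.
  - by move=> c d; rewrite (Xr a b c d) mulrNN.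
  - by move=> c; rewrite X0r mulr0.
rewrite (sum_lt_sym (f := fun a b => 2 * f a b)).
- have -> : \sum_(a < n) \sum_(b < n | (a < b)%N) 2 * f a b =
      2 * \sum_(a < n) \sum_(b < n | (a < b)%N) f a b.
    by rewrite mulr_sumr; apply: eq_bigr => a _; rewrite mulr_sumr.
  rewrite !mulrA; by rewrite (_ : 4^-1 * 2 * 2 = 1 :> R) ?mul1r //; field.
- by move=> a b; congr (_ * _); do 2! (apply: eq_bigr => ? _); rewrite Xl sqrrN.
- move=> a; rewrite /f big1 ?mulr0 // => c _; rewrite big1 // => d _.
  by rewrite X0 expr0n.
Qed.

Lemma weyl_fun_curvature_like : curvature_like weyl_fun.
Proof. exact: (W_curvature_like DD jacobi om_anti schouten_fun_sym). Qed.

Lemma nabla_weyl_normsqE (p : T) : nabla_weyl_normsq G e (sval p) =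
  4^-1 * (\sum_i dot4 (cov4 D om i weyl_fun) (cov4 D om i weyl_fun)) p.
Proof.
rewrite ev_sum mulr_sumr; apply: eq_bigr => m _.
have [al ar _] := cov4_curvature_like DD om m weyl_fun_curvature_like.
rewrite ev_dot4 mulrA mulVf ?pnatr_eq0 // mul1r -sum_lt_sym4 => [|a b c d|a b c d]; first 1 last.
- by rewrite al evN.
- by rewrite ar evN.
by do 4! (apply: eq_bigr => ? _); rewrite nabla_weylE.
Qed.

Lemma weyl_sq_sharpE (p : T) : let W := weyl_comps G e (sval p) in
  4 * inner4 W (fun i j k l => sq4 W i j k l + sharp4 W i j k l) =
  2^-1 * dot4 weyl_fun (sq2 weyl_fun) p + dot4 weyl_fun (sharp weyl_fun) p.
Proof.
rewrite /= weyl_compsE_fun !ev_dot4 [2^-1 * _]mulrCA -mulrDr; congr (_ * _).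
rewrite -[X in _ + X]mul1r -inner4D.
congr (inner4 _ _); do 4! (apply: funext => ?).
by rewrite mul1r ev_sq2 ev_sharp.
Qed.

Lemma ricci_sqE (p : T) :
  2 * inner4 (comps e (KN (Ric G e) (metric_tensor G)) (sval p)) (sq4 (weyl_comps G e (sval p))) =
  4^-1 * dot4 (KN_delta (ricci (frame_riem D om))) (sq2 weyl_fun) p.
Proof.
rewrite ev_dot4 [RHS]mulrA mulVf ?pnatr_eq0 // mul1r weyl_compsE_fun /inner4 mulrCA; congr (_ * _).
rewrite mulr_sumr; apply: eq_bigr => i _; rewrite mulr_sumr; apply: eq_bigr => j _.
rewrite mulr_sumr; apply: eq_bigr => k _; rewrite mulr_sumr; apply: eq_bigr => l _.
rewrite /comps (tens4_frame _ _ _ _ p (tens4_KN tens2_ric)) mulrCA ev_sq2.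
by rewrite [2 * _]mulrA divff ?pnatr_eq0 // mul1r.
Qed.

Lemma local_bochner (p : T) :
  let x := sval p in let W := weyl_comps G e x in
  laplacian G e (weyl_normsq G e) x =
    2 * nabla_weyl_normsq G e x
    - 4 * inner4 W (fun i j k l => sq4 W i j k l + sharp4 W i j k l)
    + 2 * inner4 (comps e (KN (Ric G e) (metric_tensor G)) x) (sq4 W).
Proof.
move=> x W; rewrite /x /W weyl_sq_sharpE ricci_sqE nabla_weyl_normsqE.
rewrite (laplacianE (phi := const_fun oU 4^-1 * dot4 weyl_fun weyl_fun)); last by move=> q;
    rewrite weyl_normsqE.
have := bochner (W := weyl_fun) (smooth_torsion_free
    (oU := oU)) DD DM jacobi om_anti dcomm schouten_fun_sym
  (fun _ _ _ _ => erefl) weyl_fun_trace_free weyl_fun_div n4.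
rewrite -(dot4_KN_delta_sq2 weyl_fun_curvature_like) => B.
rewrite frame_lap_scale.
by rewrite B evM evB evB evD !(evM _%:R) !ev_nat ev_const; field.
Qed.
End Bridge.

(** * The formula on the manifold *)

Lemma smooth_on_subset (R : realType) (V W : normedModType R) (A B : set V) (f : V -> W) :
  B `<=` A -> smooth_on A f -> smooth_on B f.
Proof.
move=> BA sf k; have {sf} := sf k; elim: k f => [|k IH] f.
  by move=> cf x Bx; exact: cf (BA x Bx).
by move=> [df cf]; split=> [x Bx|v]; [exact: df (BA x Bx) | exact: (IH _ (cf v))].
Qed.

Theorem theorem3p7 (R : realType) (n : nat) (hn : (4 <= n)%N)
  (M : closedManifold R n) (g : riemannianMetric M)
  (hW : harmonic_weyl g)
  (c : chart R n M) (U : set 'rV[R]_n) (e : 'I_n -> 'rV[R]_n -> 'rV[R]_n)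
  (he : local_onframe g c U e) (x : 'rV[R]_n) (hx : U x) :
  let G := g c in
  let W := weyl_comps G e x in
  laplacian G e (weyl_normsq G e) x =
    2 * nabla_weyl_normsq G e x
    - 4 * inner4 W (fun i j k l => sq4 W i j k l + sharp4 W i j k l)
    + 2 * inner4 (comps e (KN (Ric G e) (metric_tensor G)) x) (sq4 W).
Proof.
have [cA oU Uimg onf] := he.
have sG : smooth_on U (g c) := smooth_on_subset Uimg (gram_smooth g cA).
have symG y : U y -> (g c y)^T = g c y by move=> /Uimg; exact: gram_sym.
have div0 y : U y -> forall i j k, div_weyl (g c) e y i j k = 0 := hW c U e he y.
exact: (local_bochner oU sG symG onf hn div0 (exist _ x hx)).
Qed.
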